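(* Let $K=[a_1,a_2,\dots,a_{n+1}]$ and $K'=[a_1',a_2,\dots,a_{n+1}]$ be two $n$-simplices sharing the interior face $F=[a_2,\dots,a_{n+1}]=K\cap K'$. Suppose that for every $\{i_1,\dots,i_s\}\subset\{2,\dots,n+1\}$ with $1\le s\le n-1$, the simplices $[a_1,a_{i_1},\dots,a_{i_s}]$ and $[a_1',a_{i_1},\dots,a_{i_s}]$ are not contained in a common $s$-dimensional affine plane. Then, when $0\le k\le n-1$, it is impossible to recover the moments of $\mathcal P_1(F;\mathbb R^n)$ by $H(\mathrm{div},K\cup K';\mathbb S)$-conforming face-bubble functions of degree $k+1$; that is, there exists $\mu\in\mathcal P_1(F;\mathbb R^n)$ for which no conforming face-bubble function $\boldsymbol\tau$ of degree $k+1$ satisfies $$\int_F\boldsymbol\tau\nu_F\cdot p=\int_F\mu\cdot p\qquad\forall p\in\mathcal P_1(F;\mathbb R^n).$$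
   Context: $n\ge2$ is the space dimension; $\mathbb S$ is the space of real symmetric $n\times n$ matrices; $\mathcal P_m(D;X)$ denotes $X$-valued polynomials of degree $\le m$ on $D$; $[a_1,\dots,a_m]$ is the convex hull of the points; $\nu_F$ is a unit normal to $F$. $H(\mathrm{div},K\cup K';\mathbb S)$ is the space of square-integrable symmetric matrix fields on $K\cup K'$ with square-integrable (row-wise) divergence. An $H(\mathrm{div})$-conforming face-bubble function of degree $k+1$ associated with $F$ is $\boldsymbol\tau\in H(\mathrm{div},K\cup K';\mathbb S)$ with $\boldsymbol\tau|_K\in\mathcal P_{k+1}(K;\mathbb S)$, $\boldsymbol\tau|_{K'}\in\mathcal P_{k+1}(K';\mathbb S)$ (so that $\boldsymbol\tau\nu_F$ is continuous across $F$) and $\boldsymbol\tau\nu=0$ on every face of $K$ and of $K'$ other than $F$. *)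

(* Defs.v *)
From HB Require Import structures.
From mathcomp Require Import all_boot all_order all_algebra.
(* The notations of mpoly clash with those of the analysis library. *)
From mathcomp Require Import -(notations) mpoly.
From mathcomp Require Import all_classical all_reals all_analysis.

Set Implicit Arguments.
Unset Strict Implicit.
Unset Printing Implicit Defensive.

Import Order.TTheory GRing.Theory Num.Theory.
Import numFieldNormedType.Exports.

Local Open Scope classical_set_scope.
Local Open Scope ring_scope.

(* The points of R^n are the row vectors 'rV[R]_n.  They carry the product
   (= Borel) sigma-algebra, set up as for n.-tuple in the library. *)
Section measurable_rV.
Context {R : realType}.
Variable n : nat.

Let coors : 'I_n -> 'rV[R]_n -> R := fun i x => x ord0 i.

Let rV_set0 : g_sigma_preimage coors set0.
Proof. exact: sigma_algebra0. Qed.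

Let rV_setC A : g_sigma_preimage coors A -> g_sigma_preimage coors (~` A).
Proof. exact: sigma_algebraC. Qed.

Let rV_bigcup (F : _^nat) : (forall i, g_sigma_preimage coors (F i)) ->
  g_sigma_preimage coors (\bigcup_i (F i)).
Proof. exact: sigma_algebra_bigcup. Qed.

HB.instance Definition _ := @isMeasurable.Build default_measure_display
  'rV[R]_n (g_sigma_preimage coors) rV_set0 rV_setC rV_bigcup.

End measurable_rV.

Lemma measurable_coord (R : realType) n (i : 'I_n) :
  measurable_fun [set: 'rV[R]_n] (fun x : 'rV[R]_n => x ord0 i).
Proof.
move=> _ Y mY; rewrite setTI; apply: sub_sigma_algebra => /=.
rewrite -bigcup_seq/=; exists i => /=; first by rewrite mem_index_enum.
by exists Y => //; rewrite setTI.
Qed.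

Lemma measurable_fun_rVP d (T : measurableType d) (R : realType) n
    (f : T -> 'rV[R]_n) :
  measurable_fun [set: T] f <->
  forall i, measurable_fun [set: T] (fun t => f t ord0 i).
Proof.
split=> [mf i|mf].
  by apply: (measurableT_comp (measurable_coord i)).
apply: (@iffRL _ (g_sigma_preimage
    (fun i => (fun x : 'rV[R]_n => x ord0 i) \o f) `<=` measurable)).
  rewrite g_sigma_preimage_comp; split=> [mf' A [/= C preC <-]|prefS].
    exact: mf'.
  by move=> _ A mA; apply: prefS; exists A.
apply: smallest_sub; first exact: sigma_algebra_measurable.
case: n => [|n] in f mf *; first by rewrite big_ord0.
rewrite -bigcup_mkord_ord; apply: bigcup_sub => i Ii.
by move=> A [B mB <-]; exact: mf.
Qed.

(* n-dimensional Lebesgue measure, by recursion on n: the image of the product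
   measure under the identification R x R^n = R^(n+1) below. *)
Definition rV_cons (R : realType) n (p : measurableTypeR R * 'rV[R]_n) :
    'rV[R]_n.+1 :=
  \row_i oapp (fun j => p.2 ord0 j) p.1 (unlift ord0 i).

Definition rV_uncons (R : realType) n (x : 'rV[R]_n.+1) :
    measurableTypeR R * 'rV[R]_n :=
  (x ord0 ord0, \row_j x ord0 (lift ord0 j)).

Lemma rV_consK (R : realType) n : cancel (@rV_cons R n) (@rV_uncons R n).
Proof.
case=> a x; rewrite /rV_uncons /rV_cons mxE unlift_none /=; congr pair.
by apply/rowP => j; rewrite !mxE liftK.
Qed.

Lemma measurable_rV_cons (R : realType) n :
  measurable_fun setT (@rV_cons R n).
Proof.
apply/measurable_fun_rVP => i; rewrite /rV_cons.
under eq_fun do rewrite mxE.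
case: unliftP => [j _|_] /=; last exact: measurable_fst.
exact: (measurableT_comp (measurable_coord j) measurable_snd).
Qed.

Lemma measurable_rV_uncons (R : realType) n :
  measurable_fun setT (@rV_uncons R n).
Proof.
apply: measurable_fun_pair; first exact: measurable_coord.
apply/measurable_fun_rVP => i; under eq_fun do rewrite mxE.
exact: measurable_coord.
Qed.

Section lebesgue_rV_step.
Variables (R : realType) (n : nat).
Variable m : {sigma_finite_measure set 'rV[R]_n -> \bar R}.

Definition lebesgue_rV_step : set 'rV[R]_n.+1 -> \bar R :=
  pushforward (@lebesgue_measure R \x m)%E (@rV_cons R n).

Let mu0 : (lebesgue_rV_step set0 = 0)%E.
Proof. by rewrite /lebesgue_rV_step /pushforward preimage_set0 measure0. Qed.

Let mu_ge0 A : (0 <= lebesgue_rV_step A)%E.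
Proof. by rewrite /lebesgue_rV_step /pushforward; apply: measure_ge0. Qed.

Let mu_sigma_additive : semi_sigma_additive lebesgue_rV_step.
Proof.
move=> F mF tF mUF; rewrite /lebesgue_rV_step /pushforward preimage_bigcup.
have mpre A : measurable A -> measurable (@rV_cons R n @^-1` A).
  by move=> mA; rewrite -[X in measurable X]setTI; exact: measurable_rV_cons.
apply: measure_semi_sigma_additive.
- by move=> i; exact: mpre.
- apply/trivIsetP => /= i j _ _ ij; rewrite -preimage_setI.
  by move/trivIsetP : tF => /(_ _ _ _ _ ij) ->//; rewrite preimage_set0.
- by rewrite -preimage_bigcup; exact: mpre.
Qed.

HB.instance Definition _ := isMeasure.Build _ _ _
  lebesgue_rV_step mu0 mu_ge0 mu_sigma_additive.

Let mu_sigma_finite : sigma_finite setT lebesgue_rV_step.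
Proof.
have /sigma_finiteP[F [TF ndF Foo]] := sigma_finiteT (@lebesgue_measure R).
have /sigma_finiteP[G [TG ndG Goo]] := sigma_finiteT m.
exists (fun k => @rV_uncons R n @^-1` (F k `*` G k)).
  rewrite -preimage_bigcup -[LHS](preimage_setT (@rV_uncons R n)).
  congr (_ @^-1` _); rewrite -setXTT TF TG predeqE => -[x y]; split.
    move=> [/= [k _ Fkx] [l _ Gly]]; exists (maxn k l) => //; split.
    - by move: x Fkx; exact/subsetPset/ndF/leq_maxl.
    - by move: y Gly; exact/subsetPset/ndG/leq_maxr.
  by move=> [k _ []/= ? ?]; split; exists k.
move=> k; have [mF Fk] := Foo k; have [mG Gk] := Goo k; split.
  by rewrite -[X in measurable X]setTI; apply: measurable_rV_uncons => //;
     exact: measurableX.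
rewrite /lebesgue_rV_step /pushforward -comp_preimage.
rewrite (_ : _ \o _ = id); last by apply/funext => p /=; rewrite rV_consK.
by rewrite preimage_id product_measure1E// lte_mul_pinfty// ge0_fin_numE.
Qed.

HB.instance Definition _ := Measure_isSigmaFinite.Build _ _ _
  lebesgue_rV_step mu_sigma_finite.

End lebesgue_rV_step.

Fixpoint lebesgue_rV (R : realType) (n : nat) :
    {sigma_finite_measure set 'rV[R]_n -> \bar R} :=
  match n with
  | 0 => dirac (0 : 'rV[R]_0)
  | n'.+1 => lebesgue_rV_step (lebesgue_rV R n')
  end.

Section geometry.
Variables (R : realType) (n : nat).
Implicit Types (I : finType) (x y nu : 'rV[R]_n) (A : set 'rV[R]_n).

Definition dot x y : R := (x *m y^T) ord0 ord0.

(* M nu, for a matrix M acting on column vectors. *)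
Definition mxapp (M : 'M[R]_n) nu : 'rV[R]_n := (M *m nu^T)^T.

Definition hull I (v : I -> 'rV[R]_n) : set 'rV[R]_n :=
  [set x | exists c : I -> R,
    [/\ forall i, 0 <= c i, \sum_i c i = 1 & x = \sum_i c i *: v i]].

Definition affinely_independent I (v : I -> 'rV[R]_n) : Prop :=
  forall c : I -> R, \sum_i c i = 0 -> \sum_i c i *: v i = 0 ->
  forall i, c i = 0.

Definition affine_plane (s : nat) A : Prop :=
  exists x0 (V : 'M[R]_n), \rank V = s /\ A = [set x | (x - x0 <= V)%MS].

(* The family consisting of a and the v i. *)
Definition cone I (a : 'rV[R]_n) (v : I -> 'rV[R]_n) : option I -> 'rV[R]_n :=
  oapp v a.

Definition subfamily I (P : pred I) (v : I -> 'rV[R]_n) :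
    {i : I | P i} -> 'rV[R]_n :=
  fun i => v (val i).

Definition unit_normal A nu : Prop :=
  dot nu nu = 1 /\ forall x y, A x -> A y -> dot nu (x - y) = 0.

End geometry.
Arguments subfamily {R n I} P v _.

Section polynomial_fields.
Variables (R : realType) (n : nat).
Implicit Types (m : nat) (D : set 'rV[R]_n).

(* msize is the total degree plus one. *)
Definition poly_fun m D (f : 'rV[R]_n -> R) : Prop :=
  exists2 p : mpoly n R, (msize p <= m.+1)%N &
    forall x, D x -> f x = meval (fun i => x ord0 i) p.

Definition poly_vec m D (f : 'rV[R]_n -> 'rV[R]_n) : Prop :=
  forall i, poly_fun m D (fun x => f x ord0 i).

Definition poly_symm m D (f : 'rV[R]_n -> 'M[R]_n) : Prop :=
  (forall x, D x -> (f x)^T = f x) /\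
  forall i j, poly_fun m D (fun x => f x i j).

End polynomial_fields.

Section Hdiv.
Variables (R : realType) (n : nat).
Implicit Types (D U : set 'rV[R]_n) (f phi : 'rV[R]_n -> R).

Definition partial_deriv (j : 'I_n) f : 'rV[R]_n -> R := 'D_(delta_mx ord0 j) f.

Fixpoint Ck (k : nat) f : Prop :=
  continuous f /\
  match k with
  | 0 => True
  | k'.+1 => forall j,
      (forall x, derivable f x (delta_mx ord0 j)) /\ Ck k' (partial_deriv j f)
  end.

Definition test_function U phi : Prop :=
  [/\ forall k, Ck k phi, compact (closure [set x | phi x != 0]) &
      closure [set x | phi x != 0] `<=` U].

Definition square_integrable D f : Prop :=
  measurable_fun D f /\
  (\int[lebesgue_rV R n]_(x in D) ((f x) ^+ 2)%:E < +oo)%E.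

(* g is the row-wise divergence of tau on the interior of D, in the sense of
   distributions. *)
Definition weak_div D (tau : 'rV[R]_n -> 'M[R]_n) (g : 'rV[R]_n -> 'rV[R]_n) :
    Prop :=
  forall (i : 'I_n) phi, test_function (interior D) phi ->
  \int[lebesgue_rV R n]_(x in D) (\sum_j tau x i j * partial_deriv j phi x) =
  - \int[lebesgue_rV R n]_(x in D) (g x ord0 i * phi x).

(* H(div, D; S), for sets D with negligible boundary.  Its elements are given
   by representatives, defined up to negligible sets. *)
Definition Hdiv D (tau : 'rV[R]_n -> 'M[R]_n) : Prop :=
  [/\ {ae lebesgue_rV R n, forall x, D x -> (tau x)^T = tau x},
      forall i j, square_integrable D (fun x => tau x i j) &
      exists2 g : 'rV[R]_n -> 'rV[R]_n,
        forall i, square_integrable D (fun x => g x ord0 i) &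
        weak_div D tau g].

End Hdiv.

Section face_integral.
Variables (R : realType) (m n : nat).

Definition std_simplex : set 'rV[R]_m :=
  [set t | (forall i, 0 <= t ord0 i) /\ \sum_i t ord0 i <= 1].

(* Integral over the m-simplex hull v with respect to the m-dimensional surface
   measure: pull-back to the standard simplex by the affine parametrization
   t |-> v_0 + t E, with Jacobian sqrt (det (E E^T)). *)
Definition simplex_integral (v : 'I_m.+1 -> 'rV[R]_n) (f : 'rV[R]_n -> R) : R :=
  let E : 'M[R]_(m, n) := \matrix_i (v (lift ord0 i) - v ord0) in
  Num.sqrt (\det (E *m E^T)) *
  \int[lebesgue_rV R m]_(t in std_simplex) f (v ord0 + t *m E).

End face_integral.

Section face_bubble.
Variables (R : realType) (n : nat).
Implicit Types (a : 'rV[R]_n) (b : 'I_n -> 'rV[R]_n).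

(* sigma nu = 0 on every face of hull (cone a b) other than hull b; those faces
   are obtained by omitting one of the vertices b_j. *)
Definition zero_normal_off a b (sigma : 'rV[R]_n -> 'M[R]_n) : Prop :=
  forall (j : 'I_n) nu,
  let Fj := hull (cone a (subfamily (predC1 j) b)) in
  unit_normal Fj nu -> forall x, Fj x -> mxapp (sigma x) nu = 0.

(* tau, an element of H(div), is a conforming face-bubble function of degree k
   for the face hull b shared by hull (cone a b) and hull (cone a' b).  As tau
   is only defined almost everywhere, its restrictions to the two simplices are
   recorded as the polynomial fields sigma and sigma', through which the traces
   of tau on the faces are taken; on hull b the normal traces of sigma and
   sigma' agree, by H(div) conformity. *)
Definition face_bubble (k : nat) a a' b
    (tau sigma sigma' : 'rV[R]_n -> 'M[R]_n) : Prop :=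
  let K := hull (cone a b) in
  let K' := hull (cone a' b) in
  [/\ Hdiv (K `|` K') tau,
      poly_symm k K sigma /\
        {ae lebesgue_rV R n, forall x, K x -> tau x = sigma x},
      poly_symm k K' sigma' /\
        {ae lebesgue_rV R n, forall x, K' x -> tau x = sigma' x},
      zero_normal_off a b sigma &
      zero_normal_off a' b sigma'].

End face_bubble.

(* Main.v *)
Require Import Defs.
From mathcomp Require Import all_boot all_order all_algebra.
From mathcomp Require Import ring lra.
From mathcomp Require Import -(notations) mpoly.
From mathcomp Require Import all_classical all_reals all_analysis.
From mathcomp Require Import measurable_realfun.

Set Implicit Arguments.
Unset Strict Implicit.
Unset Printing Implicit Defensive.

Import Order.TTheory GRing.Theory Num.Theory.
Import numFieldNormedType.Exports.

Local Open Scope classical_set_scope.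
Local Open Scope ring_scope.

(** The normal-normal component of a face bubble on F is a multiple of one fixed
   function, and this leaves most first moments out of reach.

   Let lambda_j and lambda'_j be the barycentric coordinates of K and K' at the
   shared vertex b_j.  The faces other than F have the normals grad lambda_j and
   grad lambda'_j, so that tau grad lambda_j = 0 where lambda_j = 0 in K, and
   likewise in K'.  By symmetry of tau, u = tau nu_F is then orthogonal to
   grad lambda_j on the facet F_j of F where lambda_j = 0; and since u is the same
   from both sides, it is also orthogonal to grad lambda'_j there.  Both
   coordinates agree on F, so the two gradients differ by a multiple of nu_F,
   namely by lambda_j(a') grad lambda'_0, where lambda'_0 is the coordinate at a'.
   The position hypothesis, for all shared vertices but b_j, says exactly that
   lambda_j(a') is nonzero.  Hence u.nu_F vanishes on every facet F_j of F
   (normal_normal_vanish).  In space dimension n+1 the face F has n+1 facets and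
   the degree is at most n+1, so u.nu_F is a constant times the bubble beta of F,
   the product of its barycentric coordinates (facet_vanish_bubble).  The affine
   functions on F form a space of dimension at least two, so there is an affine
   q <> 0 with int_F beta q = 0 (bubble_orthogonal); then mu = q nu_F is not
   attained, because the test p = mu would give int_F q^2 = 0.

   It remains to see that the normal trace is continuous across F, from the
   existence of a square-integrable weak divergence (Hdiv_normal_continuous).
   Near an interior point x0 of F let z be the difference of two corresponding
   rows of tau, extended as polynomial fields, and let l be the affine function
   defining F, positive in K.  For test functions e, the weak divergence writes
   the integral of div(e z) over the half-space l > 0 as the integral of e
   against some integrable h.  Multiplying e by (1 - k l^2)^m does not change the
   half-space integral, because e z l^2 cut off at l = 0 is still of class C^1
   and compactly supported; but e (1 - k l^2)^m tends to 0 almost everywhere.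
   So the integral of div(e z) over the half-space is zero for all e.  If z had
   a nonzero normal component at x0, say a positive one, then for a bump e whose
   support reaches only slightly into K, around x0, div(e z) would be negative on
   the half-space, a contradiction. *)

(** * Lebesgue measure on row vectors *)

Section lebesgue_rV_facts.
Variable R : realType.

(** Balls for the norm of row vectors are boxes, whose measure is explicit. *)
Definition box n (l u : 'I_n -> R) : set 'rV[R]_n :=
  [set x | forall i, l i < x ord0 i < u i].

Lemma measurable_box n (l u : 'I_n -> R) : measurable (box l u).
Proof.
rewrite (_ : box l u = \bigcap_(i in [set: 'I_n])
    ((fun x : 'rV[R]_n => x ord0 i) @^-1` `]l i, u i[)).
  apply: fin_bigcap_measurable => [|i _]; first exact: finite_finset.
  rewrite -[X in measurable X]setTI.
  by apply: measurable_coord => //; exact: measurable_itv.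
apply/seteqP; split=> x /= H i; first by move=> _ /=; rewrite in_itv/= H.
by have /= := H i I; rewrite in_itv.
Qed.

Lemma measurable_forall n (T : finType) (P : T -> 'rV[R]_n -> Prop) :
  (forall i, measurable [set x | P i x]) ->
  measurable [set x | forall i, P i x].
Proof.
move=> mP; rewrite (_ : mkset _ = \bigcap_(i in [set: T]) [set x | P i x]).
  by apply: fin_bigcap_measurable => //; exact: finite_finset.
by apply/seteqP; split=> x /= H i; [move=> _; exact: H|exact: (H i I)].
Qed.

Lemma measurable_ge0 n (f : 'rV[R]_n -> R) : measurable_fun setT f ->
  measurable [set x | 0 <= f x].
Proof.
move=> mf; rewrite -[X in measurable X]setTI (_ : mkset _ = f @^-1` `[0, +oo[).
  by apply: mf => //; exact: measurable_itv.
by apply/seteqP; split=> x; rewrite /= in_itv/= andbT.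
Qed.

Lemma rV_cons0 n (s : R) (y : 'rV[R]_n) : rV_cons (s, y) ord0 ord0 = s.
Proof. by rewrite /rV_cons mxE unlift_none. Qed.

Lemma rV_consS n (s : R) (y : 'rV[R]_n) j :
  rV_cons (s, y) ord0 (lift ord0 j) = y ord0 j.
Proof. by rewrite /rV_cons mxE liftK. Qed.

Lemma forall_ord_recl n (P : 'I_n.+1 -> Prop) :
  (forall i, P i) <-> P ord0 /\ forall j, P (lift ord0 j).
Proof.
split=> [H|[H0 H1] i]; first by split.
by case: (unliftP ord0 i) => [j ->|->].
Qed.

Lemma lebesgue_measure_itvoo (a b : R) : a <= b ->
  lebesgue_measure (`]a, b[%classic : set R) = (b - a)%:E.
Proof.
move=> ab; rewrite lebesgue_measure_itv/= lte_fin; case: ltP => //.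
move=> ba; have -> : b = a by apply/eqP; rewrite eq_le ba ab.
by rewrite subrr.
Qed.

Lemma lebesgue_rV_box n (l u : 'I_n -> R) : (forall i, l i <= u i) ->
  lebesgue_rV R n (box l u) = (\prod_i (u i - l i))%:E.
Proof.
elim: n l u => [|n IH] l u lu.
  by rewrite big_ord0 /= diracE mem_set// => -[].
rewrite [LHS]/= /lebesgue_rV_step /pushforward.
rewrite (_ : _ @^-1` _ = `]l ord0, u ord0[%classic `*`
    box (fun j => l (lift ord0 j)) (fun j => u (lift ord0 j))); last first.
  apply/seteqP; split=> -[s y] /=; rewrite in_itv/=.
    move=> H; split=> /=; first by have := H ord0; rewrite rV_cons0.
    by move=> j; have := H (lift ord0 j); rewrite rV_consS.
  move=> [H0 H1]; apply/forall_ord_recl; rewrite rV_cons0; split=> // j.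
  by rewrite rV_consS; exact: H1.
rewrite product_measure1E//; last exact: measurable_box.
rewrite IH// [X in (X * _)%E](_ : _ = (u ord0 - l ord0)%:E).
  by rewrite -EFinM big_ord_recl.
exact: lebesgue_measure_itvoo.
Qed.

Definition cube n (B : R) : set 'rV[R]_n := box (fun=> - B) (fun=> B).

Arguments cube n B x : clear implicits.

Lemma lebesgue_cube_lty n B : (lebesgue_rV R n (cube n B) < +oo)%E.
Proof.
have [B0|B0] := leP 0 B.
  by rewrite lebesgue_rV_box ?ltry// => _; lra.
case: n => [|n].
  by rewrite lebesgue_rV_box ?ltry// => -[].
rewrite (_ : cube _ _ = set0) ?measure0//.
by apply/seteqP; split=> // x /(_ ord0) /andP[]; lra.
Qed.

Lemma cubeN n B (x : 'rV[R]_n) :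
  ~ cube n B x -> exists i, B <= `|x ord0 i|.
Proof.
move=> /existsNP[i /negP H]; exists i.
by rewrite leNgt ltr_norml.
Qed.

Lemma integrable_cube n (f : 'rV[R]_n -> R) B M :
  measurable_fun setT f -> (forall x, `|f x| <= M) ->
  (forall x, ~ cube n B x -> f x = 0) ->
  (lebesgue_rV R n).-integrable setT (EFin \o f).
Proof.
move=> mf fM f0.
have mc : measurable (cube n B) by exact: measurable_box.
have -> : EFin \o f = (EFin \o f) \_ (cube n B).
  apply/funext => x; rewrite patchE; case: ifPn => // /negP nx.
  by rewrite /= f0// => cx; apply: nx; rewrite inE.
rewrite -integrable_mkcond//; apply: measurable_bounded_integrable => //.
- exact: lebesgue_cube_lty.
- exact: measurable_funTS.
- by exists M; split; [exact: num_real|move=> N MN x _; exact: le_trans (fM x) (ltW MN)].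
Qed.

Lemma integral_lebesgue_rVS n (f : 'rV[R]_n.+1 -> \bar R) :
  (lebesgue_rV R n.+1).-integrable setT f ->
  (\int[lebesgue_rV R n.+1]_x f x =
  \int[lebesgue_measure]_s \int[lebesgue_rV R n]_y f (rV_cons (s, y)))%E /\
  (\int[lebesgue_rV R n.+1]_x f x =
  \int[lebesgue_rV R n]_y \int[lebesgue_measure]_s f (rV_cons (s, y)))%E.
Proof.
move=> intf.
have mf : measurable_fun setT f := measurable_int _ intf.
have mc := @measurable_rV_cons R n.
have intfc : (lebesgue_measure \x lebesgue_rV R n)%E.-integrable setT
    (f \o @rV_cons R n).
  apply/integrableP; split; first exact: (measurableT_comp mf mc).
  have /integrableP[_] := intf.
  rewrite (_ : integral _ _ _ = (\int[pushforward (@lebesgue_measure R \x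
     lebesgue_rV R n) (@rV_cons R n)]_x `|f x|)%E)%E//.
  rewrite ge0_integral_pushforward//.
  by apply: measurableT_comp.
have -> : (\int[lebesgue_rV R n.+1]_x f x =
   \int[(@lebesgue_measure R \x lebesgue_rV R n)]_x (f \o @rV_cons R n) x)%E.
  rewrite (_ : integral _ _ _ = (\int[pushforward (@lebesgue_measure R \x
     lebesgue_rV R n) (@rV_cons R n)]_x (f x)))%E//.
  by rewrite integral_pushforward.
split.
  by rewrite -(integral12_prod_meas1 intfc).
by rewrite -(integral21_prod_meas1 intfc).
Qed.

(** A directional derivative only depends on the function along the line, so it
transfers between a function and its restrictions to lines and to slices. *)
Lemma is_derive_line (V V' : normedModType R) (f : V -> R) (g : V' -> R)
    x v x' v' d :
  (forall h : R, g (h *: v' + x') = f (h *: v + x)) ->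
  is_derive x v f d -> is_derive x' v' g d.
Proof.
move=> gf.
have gf0 : g x' = f x by have := gf 0; rewrite !scale0r !add0r.
have E : (fun h : R => h^-1 *: ((g \o shift x') (h *: v') - g x')) =
         (fun h => h^-1 *: ((f \o shift x) (h *: v) - f x)).
  by apply/funext => h /=; rewrite gf0 -gf.
by move=> [fd <-]; split; rewrite /derivable /derive ?E.
Qed.

Lemma continuous_line n (df : 'rV[R]_n -> R) x v : continuous df ->
  continuous (fun h : R => df (h *: v + x)).
Proof.
move=> cdf h; apply: continuous_comp; last exact: cdf.
apply: continuousD; last exact: cst_continuous.
  exact: scalel_continuous.
Qed.

Lemma integral_derive1_eq0 (f df : R -> R) (B : R) : 0 < B ->
  (forall s : R, is_derive s 1 f (df s)) -> continuous df ->
  (forall s, B <= `|s| -> f s = 0) -> (forall s, B <= `|s| -> df s = 0) ->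
  (\int[lebesgue_measure]_s (df s)%:E = 0)%E.
Proof.
move=> B0 fd cdf f0 df0.
transitivity (\int[lebesgue_measure]_(s in `[(- B)%R, B]) (df s)%:E)%E.
  rewrite [RHS]integral_mkcond; apply: eq_integral => s _.
  rewrite patchE; case: ifPn => //; rewrite notin_setE/= in_itv/= => /negP.
  rewrite -ler_norml -ltNge => sB.
  by rewrite df0// ltW.
have cf : continuous f.
  by move=> s; apply/differentiable_continuous/derivable1_diffP; apply: ex_derive.
have BB : - B < B by lra.
rewrite (@continuous_FTC2 _ df f)//.
- have nB : `|B| = B by rewrite ger0_norm// ltW.
  by rewrite (f0 B) ?nB// (f0 (- B)) ?normrN ?nB// sube0.
- exact: continuous_subspaceT.
- split; first by move=> s _; apply: ex_derive.
    by apply: cvg_at_right_filter; exact: cf.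
  by apply: cvg_at_left_filter; exact: cf.
- by move=> s _; rewrite derive1E; exact: derive_val.
Qed.

Lemma rV_cons_scale_delta0 n (s h : R) (y : 'rV[R]_n) :
  rV_cons (h + s, y) = h *: delta_mx ord0 ord0 + rV_cons (s, y).
Proof.
apply/rowP => i; rewrite [RHS]mxE; have [j ->|->] := unliftP ord0 i.
  by rewrite !rV_consS 2!mxE eqxx eq_sym (negPf (neq_lift _ _)) mulr0 add0r.
by rewrite !rV_cons0 2!mxE eqxx mulr1.
Qed.

Lemma rV_cons_scale_deltaS n (s h : R) (y : 'rV[R]_n) j :
  rV_cons (s, h *: delta_mx ord0 j + y) =
  h *: delta_mx ord0 (lift ord0 j) + rV_cons (s, y).
Proof.
apply/rowP => i; rewrite [RHS]mxE; have [k ->|->] := unliftP ord0 i.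
  by rewrite !rV_consS !mxE eqxx (inj_eq lift_inj).
by rewrite !rV_cons0 2!mxE eqxx (negPf (neq_lift _ _)) mulr0 add0r.
Qed.

Lemma not_cube_cons n B s (y : 'rV[R]_n) :
  B <= `|s| \/ ~ cube n B y -> ~ cube n.+1 B (rV_cons (s, y)).
Proof.
move=> H cc; case: H => [|].
  by have := cc ord0; rewrite rV_cons0 -ltr_norml ltNge => /negP.
by apply=> j; have := cc (lift ord0 j); rewrite rV_consS.
Qed.

(** Compactly supported functions have partial derivatives of integral zero:
the fundamental theorem of calculus along coordinate 0, and induction on the
slices for the other coordinates.  Continuity is only asked for along the lines
of direction j, the form that the slices inherit. *)
Lemma integral_partial_eq0 n (j : 'I_n) (f df : 'rV[R]_n -> R) (B M : R) : 0 < B ->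
  measurable_fun setT df -> (forall x, `|df x| <= M) ->
  (forall x, is_derive x (delta_mx ord0 j) f (df x)) ->
  (forall x, continuous (fun h : R => df (h *: delta_mx ord0 j + x))) ->
  (forall x, ~ cube n B x -> f x = 0) ->
  (forall x, ~ cube n B x -> df x = 0) ->
  (\int[lebesgue_rV R n]_x (df x)%:E = 0)%E.
Proof.
move=> B0; elim: n j f df => [[]//|n IH] j f df mdf dfM fd cdf f0 df0.
have intdf := integrable_cube mdf dfM df0.
have [I12 I21] := integral_lebesgue_rVS intdf.
case: (unliftP ord0 j) fd cdf => [j' ->|->] fd cdf.
- rewrite [LHS]I12/= integral0_eq// => s _.
  apply: (IH j' (fun y => f (rV_cons (s, y)))).
  + apply: (measurableT_comp mdf).
    apply: (measurableT_comp (@measurable_rV_cons R n)).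
    exact: measurable_pair1.
  + by move=> y; exact: dfM.
  + move=> y; apply: is_derive_line (fd (rV_cons (s, y))) => h.
    by rewrite rV_cons_scale_deltaS.
  + move=> y; under eq_fun do rewrite rV_cons_scale_deltaS.
    exact: cdf.
  + by move=> y ny; apply: f0; apply: not_cube_cons; right.
  + by move=> y ny; apply: df0; apply: not_cube_cons; right.
- rewrite [LHS]I21/= integral0_eq// => y _.
  apply: (@integral_derive1_eq0 (fun s => f (rV_cons (s, y)))
           (fun s => df (rV_cons (s, y))) B) => //.
  + move=> s; apply: is_derive_line (fd (rV_cons (s, y))) => h.
    by rewrite -rV_cons_scale_delta0 /= [h *: 1]mulr1.
  + have -> : (fun s => df (rV_cons (s, y))) =
      fun s => df (s *: delta_mx ord0 ord0 + rV_cons (0, y)).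
      by apply/funext => s; rewrite -rV_cons_scale_delta0 addr0.
    exact: cdf.
  + by move=> s sB; apply: f0; apply: not_cube_cons; left.
  + by move=> s sB; apply: df0; apply: not_cube_cons; left.
Qed.

(** If the normal vector has a nonzero coordinate 0, the lines in that direction
meet the hyperplane in single points; otherwise the slices are hyperplanes of
lower dimension. *)
Lemma lebesgue_rV_hyperplane n (g : 'rV[R]_n) c : g != 0 ->
  lebesgue_rV R n [set x : 'rV[R]_n | \sum_i g ord0 i * x ord0 i = c] = 0%E.
Proof.
elim: n g c => [|n IH] g c g0; first by case/eqP: g0; apply/rowP => -[].
set H : set 'rV[R]_n.+1 := mkset _.
have mH : measurable H.
  rewrite -[X in measurable X]setTI.
  have mf : measurable_fun [set: 'rV[R]_n.+1]
      (fun x => \sum_(i < n.+1) g ord0 i * x ord0 i).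
    apply: measurable_sum => i; apply: measurable_funM => //.
    exact: measurable_coord.
  by apply: (mf _ [set c]) => //.
rewrite /= /lebesgue_rV_step /pushforward.
have mpH : measurable (@rV_cons R n @^-1` H).
  by rewrite -[X in measurable X]setTI; exact: measurable_rV_cons.
have HE s y : H (rV_cons (s, y)) <->
    g ord0 ord0 * s + \sum_i g ord0 (lift ord0 i) * y ord0 i = c.
  have E : \sum_(i < n) g ord0 (lift ord0 i) * rV_cons (s, y) ord0 (lift ord0 i) =
      \sum_i g ord0 (lift ord0 i) * y ord0 i.
    by apply: eq_bigr => i _; rewrite rV_consS.
  by rewrite /H /= big_ord_recl rV_cons0 E.
have [g00|g00] := eqVneq (g ord0 ord0) 0.
  rewrite /product_measure1 integral0_eq// => s _ /=.
  rewrite (_ : xsection _ _ = [set x : 'rV[R]_n |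
      \sum_i (\row_i g ord0 (lift ord0 i)) ord0 i * x ord0 i = c]).
    apply: IH; apply: contraNneq g0 => g'0; apply/eqP/rowP => i; rewrite mxE.
    have [j ->|->//] := unliftP ord0 i.
    by move/rowP/(_ j) : g'0; rewrite !mxE.
  apply/seteqP; split=> y; rewrite xsectionE /= => Hy.
    move/HE : Hy; rewrite g00 mul0r add0r => <-.
    by under eq_bigr do rewrite mxE.
  apply/HE; rewrite g00 mul0r add0r -Hy.
  by under [RHS]eq_bigr do rewrite mxE.
rewrite (@product_measure_unique _ _ _ _ _ _ _ (@lebesgue_measure R \x^ lebesgue_rV R n)%E)//.
  rewrite /= /product_measure2 integral0_eq// => y _ /=.
  rewrite (_ : ysection _ _ = 
      [set (c - \sum_i g ord0 (lift ord0 i) * y ord0 i) / g ord0 ord0]).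
    exact: lebesgue_measure_set1.
  apply/seteqP; split=> s; rewrite ysectionE /= => Hs.
    by move/HE : Hs => <-; field.
  by apply/HE; rewrite Hs; field.
by move=> A B mA mB; exact: product_measure2E.
Qed.

End lebesgue_rV_facts.
Arguments cube {R} n B x.

Section continuity.
Variables (R : realType) (T : topologicalType).
Implicit Types (f g : T -> R).

Lemma continuous_cst_fun (c : R) : continuous (fun _ : T => c).
Proof. exact: cst_continuous. Qed.

Lemma continuous_add_fun f g : continuous f -> continuous g ->
  continuous (fun x => f x + g x).
Proof. by move=> cf cg x; apply: (@continuousD _ _ _ f g); [exact: cf|exact: cg]. Qed.

Lemma continuous_mul_fun f g : continuous f -> continuous g ->
  continuous (fun x => f x * g x).
Proof. by move=> cf cg x; apply: (@continuousM _ _ f g); [exact: cf|exact: cg]. Qed.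

Lemma nbhs_gt f (p : T) a : continuous f -> a < f p ->
  nbhs p [set x | a < f x].
Proof.
move=> cf afp; apply: open_nbhs_nbhs; split => //.
by apply: (@open_comp _ _ f [set y | a < y]) => [x _|]; [exact: cf|exact: open_gt].
Qed.

Lemma continuous_sum_fun I (r : seq I) (f : I -> T -> R) :
  (forall i, continuous (f i)) -> continuous (fun x => \sum_(i <- r) f i x).
Proof.
move=> cf; elim: r => [|i r IH].
  by under eq_fun do rewrite big_nil; exact: continuous_cst_fun.
by under eq_fun do rewrite big_cons; exact: continuous_add_fun.
Qed.

End continuity.

(** * Smooth functions flat at the edge of their support *)

Section flat_exp_theory.
Variable R : realType.

(** The functions q(1/u) exp(-1/u), extended by 0: this family is closed under
differentiation, which makes exp(-1/u) smooth at 0. *)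
Definition flat_exp (q : {poly R}) (u : R) : R :=
  if 0 < u then q.[u^-1] * expR (- u^-1) else 0.

Lemma flat_exp_le0 q u : u <= 0 -> flat_exp q u = 0.
Proof. by rewrite /flat_exp ltNge => ->. Qed.

Lemma flat_exp1_gt0 u : 0 < u -> 0 < flat_exp 1 u.
Proof. by move=> u0; rewrite /flat_exp u0 hornerC mul1r expR_gt0. Qed.

Lemma flat_exp_mulX q u : flat_exp (q * 'X) u * u = flat_exp q u.
Proof.
rewrite /flat_exp; case: ifP => [u0|_]; last by rewrite mul0r.
by rewrite hornerMX -!mulrA; congr (_ * _); rewrite mulrC mulfK ?gt_eqF.
Qed.

Lemma flat_exp_horner q u : flat_exp q u = \sum_(i < size q) q`_i * flat_exp 'X^i u.
Proof.
rewrite /flat_exp; case: ifP => [u0|_]; last by rewrite big1// => i _; rewrite mulr0.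
rewrite horner_coef mulr_suml; apply: eq_bigr => i _.
by rewrite hornerXn mulrA.
Qed.

(** The exponential dominates its Taylor terms: exp(1/u) >= u^-(i+1) / (i+1)!. *)
Lemma flat_expXn_bound i u : `|flat_exp 'X^i u| <= i.+1`!%:R * `|u|.
Proof.
rewrite /flat_exp; case: ifP => [u0|_]; last by rewrite normr0 mulr_ge0.
rewrite hornerXn (ger0_norm (ltW u0)) ger0_norm; last first.
  by rewrite mulr_ge0 ?expR_ge0// exprn_ge0// invr_ge0 ltW.
rewrite expRN ler_pdivrMr ?expR_gt0//.
have v0 : 0 < u^-1 by rewrite invr_gt0.
have := expR_ge1Dxn i (ltW v0).
have f0 : 0 < i.+1`!%:R :> R by rewrite ltr0n fact_gt0.
move=> H.
have : u^-1 ^+ i.+1 / i.+1`!%:R <= expR u^-1 by lra.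
rewrite ler_pdivrMr// => {}H.
have -> : u^-1 ^+ i = u^-1 ^+ i.+1 * u by rewrite exprSr mulfVK ?gt_eqF.
by rewrite [leRHS]mulrAC ler_pM2r// [leRHS]mulrC.
Qed.

Lemma flat_exp_bound q u :
  `|flat_exp q u| <= (\sum_(i < size q) `|q`_i| * i.+1`!%:R) * `|u|.
Proof.
rewrite flat_exp_horner (le_trans (ler_norm_sum _ _ _))// mulr_suml.
by apply: ler_sum => i _; rewrite normrM -mulrA ler_wpM2l// flat_expXn_bound.
Qed.

Lemma flat_exp_continuous0 q : {for 0, continuous (flat_exp q)}.
Proof.
rewrite /prop_for /continuous_at flat_exp_le0//.
set C := \sum_(i < size q) `|q`_i| * i.+1`!%:R.
have C0 : (fun u : R => C * `|u|) @ (0 : R) --> (0 : R).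
  have : (fun u : R => C * `|u|) @ (0 : R) --> C * `|0 : R|.
    by apply: cvgM; [exact: cvg_cst|apply: cvg_norm; exact: cvg_id].
  by rewrite normr0 mulr0.
apply: (@squeeze_cvgr _ _ _ _ (fun u => - (C * `|u|)) (fun u => C * `|u|)) => //.
- by apply: nearW => u; rewrite -ler_norml flat_exp_bound.
- by rewrite -[X in _ --> X](@oppr0 R); exact: (cvgN C0).
Qed.

(** The derivative of q(1/u) exp(-1/u) is (1/u)^2 (q - q')(1/u) exp(-1/u). *)
Definition flat_exp_der (q : {poly R}) : {poly R} := 'X^2 * (q - q^`()).

Lemma is_derive_flat_exp (q : {poly R}) (u : R) :
  is_derive u (1 : R) (flat_exp q) (flat_exp (flat_exp_der q) u).
Proof.
have [u0|u0|->] := ltgtP u 0.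
- rewrite flat_exp_le0 ?ltW//.
  apply: (@near_eq_is_derive _ _ _ (cst 0)).
  near=> v; rewrite flat_exp_le0// ltW//; near: v; exact: lt_nbhsl.
- have dV : is_derive u (1 : R) (fun v : R => v^-1) (- u ^- 2).
    apply: is_derive_eq; first by apply: is_deriveV; rewrite gt_eqF.
    by rewrite /= [_ *: 1]mulr1.
  have d1 := @is_derive1_comp _ (horner q) (fun v : R => v^-1) u _ _
    (is_derive_poly q u^-1) dV.
  have d2 := @is_derive1_comp _ expR (fun v : R => - v^-1) u _ _
    (is_derive_expR (- u^-1)) (is_deriveN dV).
  have d : is_derive u (1 : R) (fun v : R => q.[v^-1] * expR (- v^-1))
      (flat_exp (flat_exp_der q) u).
    apply: (is_derive_eq (is_deriveM d1 d2)).
    rewrite /flat_exp u0 /flat_exp_der !hornerE /=.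
    rewrite /GRing.scale /= exprVn; ring.
  apply: near_eq_is_derive d.
  by near=> v; rewrite /flat_exp ifT//; near: v; exact: lt_nbhsr.
(* at 0 the difference quotient belongs to the family again, with q * 'X *)
- rewrite flat_exp_le0//; apply/is_derive1_caratheodory.
  exists (flat_exp (q * 'X)); split; last by rewrite flat_exp_le0.
    by move=> z; rewrite (flat_exp_le0 q (lexx 0)) !subr0 flat_exp_mulX.
  exact: flat_exp_continuous0.
Unshelve. all: by end_near. Qed.

Lemma flat_exp_continuous q : continuous (flat_exp q).
Proof.
move=> u; apply/differentiable_continuous/derivable1_diffP.
by apply: ex_derive; exact: is_derive_flat_exp.
Qed.

End flat_exp_theory.

(** * Polynomials and a differentially closed class of smooth functions *)

Section polynomial_functions.
Variables (R : realType) (n : nat).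
Implicit Types (p : mpoly n R) (x : 'rV[R]_n).

Definition mev p x : R := meval (fun i => x ord0 i) p.

Lemma mevD p q : mev (p + q) = mev p \+ mev q.
Proof. by apply/funext => x; rewrite /mev mevalD. Qed.

Lemma mevM p q : mev (p * q) = mev p \* mev q.
Proof. by apply/funext => x; rewrite /mev mevalM. Qed.

Lemma mevC (c : R) x : mev (mpolyC n c) x = c.
Proof. exact: mevalC. Qed.

Lemma mev_sum (I : Type) (r : seq I) (P : pred I) (F : I -> mpoly n R) x :
  mev (\sum_(i <- r | P i) F i) x = \sum_(i <- r | P i) mev (F i) x.
Proof. by rewrite /mev raddf_sum. Qed.

Lemma mevX m x : mev (mpolyX R m) x = \prod_i x ord0 i ^+ m i.
Proof. by rewrite /mev mevalX. Qed.

Lemma mevZ (c : R) p x : mev (c *: p) x = c * mev p x.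
Proof. by rewrite /mev mevalZ. Qed.

Lemma mderivXU i j :
  mderiv j (mpolyX R (mnm1 i)) = mpolyC n (i == j)%:R.
Proof.
rewrite mderivX mnm1E; case: eqP => [->|_]; last by rewrite scale0r mpolyC0.
have -> : mnm_sub (mnm1 j) (mnm1 j) = mnm0 :> multinom n.
  by apply/mnmP => k; rewrite mnmBE subnn mnm0E.
by rewrite mpolyX0 scale1r.
Qed.

Lemma msize_sum_le (I : Type) (r : seq I) (P : pred I) (F : I -> mpoly n R) d :
  (forall i, P i -> (msize (F i) <= d)%N) ->
  (msize (\sum_(i <- r | P i) F i) <= d)%N.
Proof.
move=> Fd; apply: (big_ind (fun q => msize q <= d)%N) => //.
  by rewrite msize0.
move=> p q pd qd; apply: leq_trans (msizeD_le _ _) _.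
by rewrite geq_max pd qd.
Qed.

Lemma mpoly_ring_ind (P : mpoly n R -> Prop) :
  (forall c, P (mpolyC n c)) -> (forall i, P (mpolyX R (mnm1 i))) ->
  (forall p q, P p -> P q -> P (p + q)) ->
  (forall p q, P p -> P q -> P (p * q)) -> forall p, P p.
Proof.
move=> PC PX PD PM p; rewrite (mpolyE p).
elim/big_rec: _ => [|m q _ Pq]; first by rewrite -mpolyC0; exact: PC.
apply: PD Pq; rewrite -mul_mpolyC; apply: (PM _ _); first exact: PC.
rewrite mpolyXE_id; elim/big_rec: _ => [|i r _ Pr]; first exact: PC.
apply: (PM _ _) Pr; elim: (m i) => [|k IH]; first by rewrite expr0; exact: PC.
by rewrite exprS; apply: (PM _ _) IH; exact: PX.
Qed.

Lemma mev_continuous p : continuous (mev p).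
Proof.
elim/mpoly_ring_ind : p => [c|i|p q cp cq|p q cp cq] x.
- rewrite (_ : mev _ = cst c); first exact: cst_continuous.
  by apply/funext => y; rewrite /mev mevalC.
- rewrite (_ : mev _ = fun y : 'rV[R]_n => y ord0 i); first exact: coord_continuous.
  by apply/funext => y; rewrite /mev mevalXU.
- by rewrite mevD; apply: continuousD; [exact: cp|exact: cq].
- by rewrite mevM; apply: continuousM; [exact: cp|exact: cq].
Qed.

Lemma measurable_mev p : measurable_fun setT (mev p).
Proof.
elim/mpoly_ring_ind : p => [c|i|p q cp cq|p q cp cq].
- rewrite (_ : mev _ = cst c); first exact: measurable_cst.
  by apply/funext => y; rewrite /mev mevalC.
- rewrite (_ : mev _ = fun y : 'rV[R]_n => y ord0 i); first exact: measurable_coord.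
  by apply/funext => y; rewrite /mev mevalXU.
- by rewrite mevD; apply: measurable_funD.
- by rewrite mevM; apply: measurable_funM.
Qed.

Lemma is_derive_mev p j x :
  is_derive x (delta_mx ord0 j) (mev p) (mev (mderiv j p) x).
Proof.
elim/mpoly_ring_ind : p => [c|i|p q cp cq|p q cp cq].
- rewrite (_ : mev _ = cst c).
    by rewrite mderivC /mev meval0; exact: is_derive_cst.
  by apply/funext => y; rewrite /mev mevalC.
- rewrite (_ : mev _ = fun y : 'rV[R]_n => y ord0 i); last first.
    by apply/funext => y; rewrite /mev mevalXU.
  rewrite mderivXU mevC; apply: (@is_derive_line R (R : normedModType R) 'rV[R]_n
     (fun h => (h * (i == j)%:R + x ord0 i)) _ 0 1).
    by move=> h /=; rewrite !mxE eqxx [h *: 1]mulr1 addr0.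
  by apply: is_derive_eq; rewrite /GRing.scale/=; ring.
- by rewrite mevD mderivD mevD; exact: is_deriveD.
- rewrite mevM mderivM mevD !mevM.
  by apply: (is_derive_eq (is_deriveM cp cq)); rewrite /GRing.scale /=; ring.
Qed.
End polynomial_functions.

Section smooth.
Variables (R : realType) (n : nat).
Implicit Types (x : 'rV[R]_n).

(** Test functions have to be infinitely differentiable and their derivatives are
needed explicitly; syntax trees make both immediate, since differentiation
maps trees to trees. *)
Inductive smooth_expr :=
| SPoly of mpoly n R
| SAdd of smooth_expr & smooth_expr
| SMul of smooth_expr & smooth_expr
| SFlat of {poly R} & smooth_expr.

Fixpoint seval (e : smooth_expr) (x : 'rV[R]_n) : R :=
  match e with
  | SPoly p => mev p x
  | SAdd e1 e2 => seval e1 x + seval e2 x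
  | SMul e1 e2 => seval e1 x * seval e2 x
  | SFlat q e1 => flat_exp q (seval e1 x)
  end.

Fixpoint sderiv (j : 'I_n) (e : smooth_expr) : smooth_expr :=
  match e with
  | SPoly p => SPoly (mderiv j p)
  | SAdd e1 e2 => SAdd (sderiv j e1) (sderiv j e2)
  | SMul e1 e2 => SAdd (SMul e1 (sderiv j e2)) (SMul e2 (sderiv j e1))
  | SFlat q e1 => SMul (SFlat (flat_exp_der q) e1) (sderiv j e1)
  end.

Lemma seval_continuous e : continuous (seval e).
Proof.
elim: e => [p|e1 c1 e2 c2|e1 c1 e2 c2|q e1 c1] x /=.
- exact: mev_continuous.
- by apply: continuousD; [exact: c1|exact: c2].
- by apply: continuousM; [exact: c1|exact: c2].
- by apply: continuous_comp; [exact: c1|exact: flat_exp_continuous].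
Qed.

Lemma measurable_seval e : measurable_fun setT (seval e).
Proof.
elim: e => [p|e1 c1 e2 c2|e1 c1 e2 c2|q e1 c1] /=.
- exact: measurable_mev.
- exact: measurable_funD.
- exact: measurable_funM.
- apply: measurableT_comp c1; apply: continuous_measurable_fun.
  exact: flat_exp_continuous.
Qed.

Lemma is_derive_line1 (V : normedModType R) (f : V -> R) (x v : V) (d : R) :
  is_derive x v f d <-> is_derive (0 : R) (1 : R) (fun h => f (h *: v + x)) d.
Proof.
by split; apply: is_derive_line => h; rewrite [h *: 1]mulr1 addr0.
Qed.

Lemma is_derive_seval e j x : is_derive x (delta_mx ord0 j) (seval e) (seval (sderiv j e) x).
Proof.
elim: e => [p|e1 c1 e2 c2|e1 c1 e2 c2|q e1 c1] /=.
- exact: is_derive_mev.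
- exact: is_deriveD.
- exact: is_deriveM.
- apply/is_derive_line1.
  apply: (@is_derive1_comp _ (flat_exp q) (fun h => seval e1 (h *: delta_mx ord0 j + x))).
    by rewrite scale0r add0r; exact: is_derive_flat_exp.
  exact: (is_derive_line1 _ _ _ _).1 c1.
Qed.

Lemma partial_seval e j : partial_deriv j (seval e) = seval (sderiv j e).
Proof.
by apply/funext => x; have := is_derive_seval e j x; rewrite /partial_deriv => -[_ ->].
Qed.

Lemma Ck_seval k e : Ck k (seval e).
Proof.
elim: k e => [|k IH] e /=; first by split=> //; exact: seval_continuous.
split=> [|j]; first exact: seval_continuous.
split; last by rewrite partial_seval.
by move=> x; apply: ex_derive; exact: is_derive_seval.
Qed.

Lemma sderiv_open0 e j (U : set 'rV[R]_n) : open U ->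
  (forall x, U x -> seval e x = 0) -> forall x, U x -> seval (sderiv j e) x = 0.
Proof.
move=> oU e0 x Ux.
have d0 : is_derive x (delta_mx ord0 j) (seval e) 0.
  apply: (@near_eq_is_derive _ _ _ (cst 0) _ _ _ _ _ (is_derive_cst 0 x _)).
  by near=> y; rewrite e0//; near: y; exact: open_nbhs_nbhs.
by have [_ <-] := is_derive_seval e j x; have [_ ->] := d0.
Unshelve. all: by end_near. Qed.

Lemma continuous_bounded_cube (f : 'rV[R]_n -> R) B : continuous f ->
  exists M, forall x, cube n B x -> `|f x| <= M.
Proof.
move=> cf.
have cK : compact [set v : 'rV[R]_n | forall i, v ord0 i \in `[(- B), B]].
  apply: (@rV_compact _  _ (fun=> `[(- B), B]%classic)).
  by move=> _; exact: segment_compact.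
have /compact_bounded[M [_ HM]] : compact (f @` [set v : 'rV[R]_n | forall i, v ord0 i \in `[(- B), B]]).
  by apply: continuous_compact => //; exact: continuous_subspaceT.
exists (M + 1) => x cx; apply: (HM (M + 1)); first by rewrite ltrDl.
exists x => // i; rewrite in_itv/=; have /andP[/ltW -> /ltW ->//] := cx i.
Qed.

End smooth.

(** * The divergence theorem on a half-space, without boundary term *)

Lemma Rintegral_sum d (T : measurableType d) (R : realType)
    (mu : {measure set T -> \bar R}) (I : Type) (s : seq I) (f : I -> T -> R) :
  (forall i, mu.-integrable setT (EFin \o f i)) ->
  \int[mu]_x (\sum_(i <- s) f i x) = \sum_(i <- s) \int[mu]_x f i x.
Proof.
move=> intf; elim: s => [|i s IH].
  under eq_Rintegral do rewrite big_nil.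
  by rewrite big_nil /Rintegral integral0.
under eq_Rintegral do rewrite big_cons.
rewrite RintegralD ?IH ?big_cons//.
apply: (eq_integrable _ (fun x => \sum_(i <- s) (f i x)%:E)%E) => //.
  by move=> x _; rewrite /= sumEFin.
by apply: integrable_sum => // k _; exact: intf.
Qed.

Section smooth_integrals.
Variables (R : realType) (n : nat).
Notation mu := (lebesgue_rV R n).
Implicit Types (x : 'rV[R]_n) (e : smooth_expr R n).

Definition bsupp e B := forall x, ~ cube n B x -> seval e x = 0.

Definition far B : set 'rV[R]_n := [set x | exists i, B < `|x ord0 i|].

Lemma open_far B : open (far B).
Proof.
rewrite (_ : far B = \bigcup_(i in [set: 'I_n]) [set x | B < `|x ord0 i|]).
  apply: bigcup_open => i _.
  apply: (@open_comp _ _ (fun x : 'rV[R]_n => `|x ord0 i|) [set y | B < y]).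
    move=> x _; apply: continuous_comp; first exact: coord_continuous.
    exact: norm_continuous.
  exact: open_gt.
by apply/seteqP; split=> x [i]; [exists i|move=> _; exists i].
Qed.

Lemma bsupp_sderiv e B j : bsupp e B -> bsupp (sderiv j e) (B + 1).
Proof.
move=> eB x /cubeN[i xi]; apply: (sderiv_open0 j (open_far (B := B))).
  move=> y [k yk]; apply: eB => /(_ k); rewrite -ltr_norml.
  by rewrite ltNge (ltW yk).
by exists i; rewrite (lt_le_trans _ xi)// ltrDl.
Qed.

Lemma bsupp_mono e B B' : B <= B' -> bsupp e B -> bsupp e B'.
Proof.
move=> BB' eB x nx; apply: eB => cx; apply: nx => i.
by have /andP[a b] := cx i; apply/andP; split; lra.
Qed.

Lemma bsupp_bounded e B : bsupp e B -> exists M, forall x, `|seval e x| <= M.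
Proof.
move=> eB; have [M HM] := continuous_bounded_cube B (@seval_continuous _ _ e).
exists (Num.max M 0) => x; rewrite le_max.
have [cx|/eB ->] := pselect (cube n B x); first by rewrite HM.
by rewrite normr0 lexx orbT.
Qed.

Lemma bsupp_integrable e B : bsupp e B -> mu.-integrable setT (EFin \o seval e).
Proof.
move=> eB; have [M HM] := bsupp_bounded eB.
exact: integrable_cube (@measurable_seval _ _ e) HM eB.
Qed.

Lemma integral_sderiv e B j : bsupp e B -> \int[mu]_x seval (sderiv j e) x = 0.
Proof.
move=> eB; pose B1 := Num.max (B + 1) 1.
have eB1 : bsupp e B1 by apply: bsupp_mono eB; rewrite le_max lerDl ler01.
have dB1 : bsupp (sderiv j e) B1.
  by apply: bsupp_mono (bsupp_sderiv j eB); rewrite le_max lexx.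
have [M HM] := bsupp_bounded dB1.
have B10 : 0 < B1 by rewrite lt_max ltr01 orbT.
have line x : continuous (fun h : R => seval (sderiv j e) (h *: delta_mx ord0 j + x)).
  by apply: continuous_line; exact: seval_continuous.
rewrite /Rintegral (integral_partial_eq0 B10 (@measurable_seval _ _ _) HM
  (is_derive_seval e j) line eB1 dB1).
by [].
Qed.

Lemma is_derive_pos2 (u : R) :
  is_derive u (1 : R) (fun v : R => Num.max 0 v ^+ 2) (2 * Num.max 0 u).
Proof.
have sq (v : R) : Num.max 0 v ^+ 2 = Num.max 0 v * v.
  by rewrite expr2; case: (leP 0 v) => _; rewrite ?mul0r.
have [u0|u0|->] := ltgtP u 0.
- rewrite mulr0.
  apply: near_eq_is_derive (is_derive_cst 0 u 1).
  near=> v; rewrite max_l ?expr0n//= ltW//; near: v; exact: lt_nbhsl.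
-
  have d : is_derive u (1 : R) ((@idfun R) ^+ 2) (2 * u).
    by apply: is_derive_eq; rewrite /GRing.scale /=; ring.
  apply: near_eq_is_derive d.
  near=> v; rewrite max_r ?fctE//= ltW//; near: v; exact: lt_nbhsr.
- rewrite mulr0; apply/is_derive1_caratheodory.
  exists (Num.max 0); split; last by rewrite maxxx.
    by move=> v; rewrite maxxx expr0n/= !subr0 sq.
  apply: (@continuous_max _ _ (cst 0) id); first exact: cst_continuous.
  exact: id.
Unshelve. all: by end_near. Qed.

Definition affine_mpoly (g : 'rV[R]_n) (c : R) : mpoly n R :=
  mpolyC n c + \sum_i g ord0 i *: mpolyX R (mnm1 i).

Lemma mev_affine g c x : mev (affine_mpoly g c) x = c + \sum_i g ord0 i * x ord0 i.
Proof.
rewrite /mev mevalD mevalC raddf_sum; congr (_ + _); apply: eq_bigr => i _.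
by rewrite /= mevalZ mevalXU.
Qed.

Lemma mderiv_affine g c j : mderiv j (affine_mpoly g c) = mpolyC n (g ord0 j).
Proof.
rewrite mderivD mderivC add0r raddf_sum/= (bigD1 j)//= big1 ?addr0 => [|i ij].
  by rewrite mderivZ mderivXU eqxx -mul_mpolyC mpolyC1 mulr1.
by rewrite mderivZ mderivXU (negPf ij) mpolyC0 scaler0.
Qed.

Section half_space.
Variables (g : 'rV[R]_n) (c : R).
Let lp := affine_mpoly g c.
Let l := mev lp.
Let H := [set x | 0 <= l x].

Lemma measurable_half : measurable H.
Proof. by apply: measurable_ge0; exact: measurable_mev. Qed.

Lemma half_integrable e B : bsupp e B ->
  mu.-integrable setT (EFin \o (fun x => \1_H x * seval e x)).
Proof.
move=> eB; have [M HM] := bsupp_bounded eB.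
apply: (@integrable_cube _ _ _ B M).
- apply: measurable_funM; last exact: measurable_seval.
  by apply: measurable_indic; exact: measurable_half.
- move=> x; rewrite indicE; case: (_ \in _); rewrite ?mul1r ?mul0r ?normr0//.
  exact: le_trans (HM x).
- by move=> x /eB ->; rewrite mulr0.
Qed.

Definition sqr_times e := SMul (SPoly (lp * lp)) e.

Lemma bsupp_sqr_times e B : bsupp e B -> bsupp (sqr_times e) B.
Proof. by move=> eB x /eB /= ->; rewrite mulr0. Qed.

(** No boundary term appears when the integrand is multiplied by l^2: the
truncation of l^2 e to the half-space 0 <= l is the C^1 function (l_+)^2 e, of
compact support, and its partial derivatives have integral zero. *)
Lemma half_integral_sqr_sderiv e B j : bsupp e B ->
  \int[mu]_x (\1_H x * seval (sderiv j (sqr_times e)) x) = 0.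
Proof.
move=> eB0; pose B1 := Num.max (B + 1) 1.
have B10 : 0 < B1 by rewrite lt_max ltr01 orbT.
have eB : bsupp e B1 by apply: bsupp_mono eB0; rewrite le_max lerDl ler01.
have dB : bsupp (sderiv j e) B1.
  by apply: bsupp_mono (bsupp_sderiv j eB0); rewrite le_max lexx.
have sB : bsupp (sderiv j (sqr_times e)) B1.
  apply: bsupp_mono (bsupp_sderiv j (bsupp_sqr_times eB0)).
  by rewrite le_max lexx.
pose m (x : 'rV[R]_n) : R := Num.max 0 (l x).
pose f x : R := m x ^+ 2 * seval e x.
pose df x : R := \1_H x * seval (sderiv j (sqr_times e)) x.
have dfE x : df x = m x ^+ 2 * seval (sderiv j e) x + seval e x * (2 * m x * g ord0 j).
  rewrite /df indicE; have [Hx|Hx] := boolP (x \in H); last first.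
    move: Hx; rewrite notin_setE /H/= => /negP; rewrite -ltNge => lx.
    by rewrite /m (max_l (ltW lx)) expr0n/=; ring.
  move: Hx; rewrite inE /H /= => lx; rewrite /m (max_r lx) mevM /= mderivM.
  rewrite (mevD (_ * _)) !mevM /= mderiv_affine !mevC -/l; ring.
have lcont : continuous l by exact: mev_continuous.
have mcont : continuous m.
  move=> x; apply: (@continuous_max _ _ (cst 0) l); first exact: cst_continuous.
  exact: lcont.
have dfcont : continuous df.
  rewrite (funext dfE).
  apply: continuous_add_fun; apply: continuous_mul_fun; try exact: seval_continuous.
    move=> x; apply: (@continuous_comp _ _ _ m (fun v : R => v ^+ 2)).
      exact: mcont.
    exact: exprn_continuous.
  apply: continuous_mul_fun; last exact: continuous_cst_fun.
  by apply: continuous_mul_fun => //; exact: continuous_cst_fun.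
have [M HM] := bsupp_bounded sB.
have bdf x : `|df x| <= M.
  rewrite /df indicE; case: (_ \in _); rewrite ?mul1r ?mul0r ?normr0//.
  exact: le_trans (HM x).
have mdf : measurable_fun setT df.
  apply: measurable_funM; last exact: measurable_seval.
  by apply: measurable_indic; exact: measurable_half.
have fd x : is_derive x (delta_mx ord0 j) f (df x).
  have dl : is_derive x (delta_mx ord0 j) (fun y => m y ^+ 2)
      (2 * m x * g ord0 j).
    apply/is_derive_line1.
    apply: (@is_derive1_comp _ (fun v : R => Num.max 0 v ^+ 2)
             (fun h => l (h *: delta_mx ord0 j + x))).
      by rewrite scale0r add0r; exact: is_derive_pos2.
    apply: (is_derive_line1 _ _ _ _).1; have := is_derive_mev lp j x.
    by rewrite mderiv_affine mevC.
  by rewrite dfE; exact: (is_deriveM dl (is_derive_seval e j x)).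
rewrite /Rintegral (integral_partial_eq0 B10 mdf bdf fd (fun x => continuous_line dfcont)) //.
- by move=> x /eB; rewrite /f => ->; rewrite mulr0.
- by move=> x /sB; rewrite /df => ->; rewrite mulr0.
Qed.

Variable z : 'I_n -> mpoly n R.

(** The divergence of the vector field e z, where z is a polynomial field. *)
Definition field_div e x : R := \sum_j seval (sderiv j (SMul (SPoly (z j)) e)) x.

(** By the divergence theorem this is the flux of e z through the hyperplane l = 0,
up to a constant factor; it stands in for that surface integral. *)
Definition half_div e : R := \int[mu]_x (\1_H x * field_div e x).

Lemma bsupp_mul p e B : bsupp e B -> bsupp (SMul (SPoly p) e) B.
Proof. by move=> eB x /eB /= ->; rewrite mulr0. Qed.

Lemma half_divE e B : bsupp e B ->
  half_div e = \sum_j \int[mu]_x (\1_H x * seval (sderiv j (SMul (SPoly (z j)) e)) x).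
Proof.
move=> eB; rewrite -Rintegral_sum.
  by apply: eq_Rintegral => x _; rewrite mulr_sumr.
by move=> j; exact: (half_integrable (bsupp_sderiv j (bsupp_mul (z j) eB))).
Qed.

Lemma half_div_sqr e B : bsupp e B -> half_div (sqr_times e) = 0.
Proof.
move=> eB; rewrite (half_divE (bsupp_sqr_times eB)) big1// => j _.
rewrite -[RHS](half_integral_sqr_sderiv j (bsupp_mul (z j) eB)).
apply: eq_Rintegral => x _; congr (_ * _); rewrite /= !mevM mderivM (mevD (_ * _)) !mevM /=; ring.
Qed.

Lemma half_divD e1 e2 B : bsupp e1 B -> bsupp e2 B ->
  half_div (SAdd e1 e2) = half_div e1 + half_div e2.
Proof.
move=> e1B e2B.
have e12B : bsupp (SAdd e1 e2) B by move=> x nx /=; rewrite e1B// e2B// addr0.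
rewrite (half_divE e1B) (half_divE e2B) (half_divE e12B) -big_split; apply: eq_bigr => j _ /=.
rewrite -RintegralD//.
- apply: eq_Rintegral => x _ /=; ring.
- exact: (half_integrable (bsupp_sderiv j (bsupp_mul (z j) e1B))).
- exact: (half_integrable (bsupp_sderiv j (bsupp_mul (z j) e2B))).
Qed.

End half_space.
End smooth_integrals.

(** * Vanishing of the normal component of a jump *)

Section normal_component.
Variables (R : realType) (n : nat).
Notation mu := (lebesgue_rV R n).
Implicit Types (x : 'rV[R]_n) (e : smooth_expr R n).

Lemma nbhs_box (p : 'rV[R]_n) (V : set 'rV[R]_n) : nbhs p V ->
  exists2 r : R, 0 < r &
    box (fun i => p ord0 i - r) (fun i => p ord0 i + r) `<=` V.
Proof.
move=> /nbhs_ballP[r /= r0 rV]; exists r => // x bx; apply: rV.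
split=> // i j; rewrite (ord1 i) /ball/= distrC ltr_norml.
by have := bx j; lra.
Qed.

(** Nonempty open sets have positive measure. *)
Lemma integral_eq0_nbhs (f : 'rV[R]_n -> R) (p : 'rV[R]_n) (V : set 'rV[R]_n) :
  (forall x, 0 <= f x) ->
  mu.-integrable setT (EFin \o f) -> \int[mu]_x f x = 0 -> nbhs p V ->
  exists2 x, V x & f x = 0.
Proof.
move=> f0 intf If0 /nbhs_box[r r0 rV].
have mf := measurable_int _ intf.
have : (\int[mu]_x `|(EFin \o f) x| = 0)%E.
  under eq_integral do rewrite gee0_abs ?lee_fin//.
  have fin : (\int[mu]_x (EFin \o f) x)%E \is a fin_num by exact: integrable_fin_num.
  by rewrite -(fineK fin); congr (_%:E).
move/(ae_eq_integral_abs _ measurableT mf) => [N [mN N0 fN]].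
apply: contrapT => nV.
have : (0 < mu (box (fun i => p ord0 i - r) (fun i => p ord0 i + r))%R)%E.
  rewrite lebesgue_rV_box => [|i]; last by lra.
  by rewrite lte_fin; apply: prodr_gt0 => i _; lra.
rewrite ltNge => /negP; apply; rewrite -N0; apply: le_measure; rewrite ?inE//.
  exact: measurable_box.
move=> x bx; apply: fN => /= /(_ I) => -[fx0].
by apply: nV; exists x => //; exact: rV.
Qed.

Section paraboloid.
Variables (g x0 : 'rV[R]_n) (t s : R).

Let w j : mpoly n R := mpolyX R (mnm1 j) - mpolyC n (x0 ord0 j).

(** Its positivity set is the ball |w + t g|^2 < s + t^2 |g|^2, w = x - x0; the
part of this ball in the half-space g.w >= 0 is a cap around x0, contained in
|w|^2 < s. *)
Definition cap_mpoly : mpoly n R :=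
  mpolyC n s - \sum_j (w j * w j + mpolyC n (2 * t * g ord0 j) * w j).

Lemma mev_cap x : mev cap_mpoly x =
  s - \sum_j ((x ord0 j - x0 ord0 j) ^+ 2 +
              2 * t * g ord0 j * (x ord0 j - x0 ord0 j)).
Proof.
rewrite /mev mevalB mevalC [meval _ (\sum_j _)]raddf_sum; congr (_ - _); apply: eq_bigr => j _ /=.
by rewrite mevalD !mevalM mevalB !mevalC mevalXU expr2.
Qed.

Lemma mev_mderiv_cap j x : mev (mderiv j cap_mpoly) x =
  - (2 * (x ord0 j - x0 ord0 j + t * g ord0 j)).
Proof.
rewrite /cap_mpoly mderivB mderivC sub0r /mev mevalN; congr (- _).
rewrite [mderiv j _]raddf_sum [meval _ _]raddf_sum /= (bigD1 j)//= big1 ?addr0 => [|i ij].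
  rewrite mderivD !mderivM /w mderivB !mderivC mderivXU eqxx subr0.
  rewrite mevalD !mevalD !mevalM !mevalB !mevalC mevalXU ?meval0 mulr1n; ring.
rewrite mderivD !mderivM /w mderivB !mderivC mderivXU (negPf ij) subr0.
by rewrite mevalD !mevalD !mevalM mpolyC0 meval0; ring.
Qed.

End paraboloid.

Lemma field_div_cap g x0 t s z x : 0 < mev (cap_mpoly g x0 t s) x ->
  field_div z (SFlat 1 (SPoly (cap_mpoly g x0 t s))) x =
  flat_exp 1 (mev (cap_mpoly g x0 t s) x) *
  (\sum_j mev (mderiv j (z j)) x - 2 * (mev (cap_mpoly g x0 t s) x) ^- 2 *
   \sum_j mev (z j) x * (x ord0 j - x0 ord0 j + t * g ord0 j)).
Proof.
set u := mev _ x => u0; rewrite /field_div.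
rewrite mulrBr !mulr_sumr -sumrB; apply: eq_bigr => j _ /=.
rewrite mev_mderiv_cap -/u.
have -> : flat_exp (flat_exp_der 1) u = u ^- 2 * flat_exp 1 u.
  rewrite /flat_exp u0 /flat_exp_der !hornerE/= -polyC1 derivC !hornerE.
  by rewrite ?exprVn ?subr0 ?mulr1 ?mul1r.
ring.
Qed.

(** The field e z and its product with (1 - k l^2)^m have the same half-space
integral, since their difference is divisible by l^2; but the products tend to
0 off the null set l = 0, and dominated convergence applies to the integral
against h. *)
Lemma half_div_vanish (g : 'rV[R]_n) c z (h : 'rV[R]_n -> R) (C : set 'rV[R]_n) B e :
  g != 0 -> mu.-integrable setT (EFin \o h) -> C `<=` cube n B ->
  (forall x, ~ C x -> seval e x = 0) ->
  (forall e', (forall x, ~ C x -> seval e' x = 0) ->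
     half_div g c z e' = \int[mu]_x (h x * seval e' x)) ->
  half_div g c z e = 0.
Proof.
move=> g0 inth CB eC hyp.
have CbB e' : (forall x, ~ C x -> seval e' x = 0) -> bsupp e' B.
  by move=> H x nx; apply: H => Cx; exact/nx/CB.
pose l := mev (affine_mpoly g c).
have [L HL] := continuous_bounded_cube B (@mev_continuous R n (affine_mpoly g c)).
(* this scaling gives 0 <= 1 - k l^2 <= 1 on the support *)
pose k := (L ^+ 2 + 1)^-1.
have k0 : 0 < k by rewrite invr_gt0; nra.
have kl x : C x -> 0 <= k * l x ^+ 2 <= 1.
  move=> /CB /HL lL; rewrite mulr_ge0 ?sqr_ge0 ?(ltW k0)//=.
  rewrite /k ler_pdivrMl ?mulr1; last by nra.
  have : `|l x| ^+ 2 <= L ^+ 2 by rewrite lerXn2r ?nnegrE// (le_trans _ lL).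
  by rewrite real_normK ?num_real// => H; lra.
pose step e := SAdd e (sqr_times g c (SMul (SPoly (mpolyC n (- k))) e)).
pose chi m := iter m step e.
have chiE m x : seval (chi m) x = seval e x * (1 - k * l x ^+ 2) ^+ m.
  elim: m => [|m IH]; first by rewrite expr0 mulr1.
  rewrite /chi iterS -/(chi m) /= mevC mevM /= -/l IH [_ ^+ m.+1]exprS expr2; ring.
have chiC m x : ~ C x -> seval (chi m) x = 0.
  by move=> nx; rewrite chiE eC// mul0r.
have Tchi m : half_div g c z (chi m) = half_div g c z e.
  elim: m => // m <-; rewrite /chi iterS -/(chi m) /step.
  have b1 := CbB _ (chiC m).
  have b2 : bsupp (SMul (SPoly (mpolyC n (- k))) (chi m)) B by exact: bsupp_mul.
  by rewrite (half_divD g c z b1 (bsupp_sqr_times g c b2)) (half_div_sqr g c z b2) addr0.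
have [M HM] := bsupp_bounded (CbB _ eC).
have mh : measurable_fun setT h by apply/measurable_EFinP; exact: measurable_int inth.
have chiM m x : `|seval (chi m) x| <= M.
  have [Cx|nCx] := pselect (C x); last by rewrite chiC// normr0 (le_trans _ (HM x)).
  rewrite chiE normrM (le_trans _ (HM x))// ler_piMr// normrX exprn_ile1//.
  by rewrite ler_norml; have := kl x Cx; lra.
have cv0 x : l x != 0 -> (EFin \o (fun y => h y * seval (chi m) y)) x @[m --> \oo] --> 0%E.
  move=> lx; apply: cvg_EFin; first by apply: nearW.
  have [Cx|nCx] := pselect (C x); last first.
    apply: cvg_near_cst; apply: nearW => m /=; by rewrite chiC// mulr0.
  have -> : fine \o (fun m => (EFin \o (fun y => h y * seval (chi m) y)) x) =
            geometric (h x * seval e x) (1 - k * l x ^+ 2).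
    by apply/funext => m /=; rewrite chiE mulrA.
  apply: cvg_geometric; rewrite ltr_norml.
  have := kl x Cx.
  have : 0 < k * l x ^+ 2 by rewrite mulr_gt0// exprn_even_gt0.
  by lra.
have mchi m : measurable_fun setT (fun y => h y * seval (chi m) y).
  by apply: measurable_funM => //; exact: measurable_seval.
have [|||||_ _ cvT] := @dominated_convergence _ _ _ mu setT measurableT
  (fun m => EFin \o (fun y => h y * seval (chi m) y)) (cst 0%E)
  (fun x => (M%:E * `|(h x)%:E|)%E).
- by move=> m; exact/measurable_EFinP.
- exact: measurable_cst.
- exists [set x | l x = 0]; split.
  + rewrite -[X in measurable X]setTI.
    by apply: (measurable_mev (affine_mpoly g c) measurableT (Y := [set 0])).
  + rewrite (_ : mkset _ = [set x : 'rV[R]_n | \sum_i g ord0 i * x ord0 i = - c]).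
      exact: lebesgue_rV_hyperplane.
    by apply/seteqP; split=> x /=; rewrite /l mev_affine => H; lra.
  + move=> x /= nx; apply: contrapT => /eqP lx; apply: nx => _.
    exact: cv0.
- by apply: integrableZl => //; exact: integrable_abse.
- apply/aeW => x m _ /=; rewrite -EFinM lee_fin normrM mulrC ler_wpM2r//.
have cvC : (fun m => \int[mu]_x (h x * seval (chi m) x)%:E)%E = fun=> (half_div g c z e)%:E.
  apply/funext => m; rewrite -(Tchi m) hyp; last exact: chiC.
  rewrite /Rintegral fineK//; apply: integrable_fin_num => //.
  apply: (le_integrable measurableT _ _ (g := fun x => (M%:E * (h x)%:E)%E)) => //.
  - exact/measurable_EFinP.
  - move=> x _ /=; rewrite lee_fin !normrM mulrC ler_wpM2r//.
    by rewrite (le_trans (chiM m x))// ler_norm.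
  - exact: integrableZl.
have cvT0 : (fun _ : nat => (half_div g c z e)%:E) @ \oo --> (0%E : \bar R).
  by rewrite -cvC; move: cvT; rewrite integral0.
have := cvg_lim (@ereal_hausdorff R) cvT0.
rewrite lim_cst; last exact: ereal_hausdorff.
by move=> H; apply: EFin_inj; exact: H.
Qed.

(** The half-space integral of div(e z) is the integral of e against h, so it
vanishes for all e.  If z.g > 0 at x0, the function e = exp(-1/u) on a small cap around x0
contradicts this: there div(e z) = e (div z - 2 u^-2 z.(w + t g)) with u small
and z.(w + t g) bounded below, so that the integrand is negative. *)
Lemma normal_component_le0 (g x0 : 'rV[R]_n) z (h : 'rV[R]_n -> R) (U : set 'rV[R]_n) :
  let c := - \sum_j g ord0 j * x0 ord0 j in
  g != 0 -> nbhs x0 U -> mu.-integrable setT (EFin \o h) ->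
  (forall C B e, closed C -> C `<=` cube n B -> C `<=` U ->
     (forall x, ~ C x -> seval e x = 0) ->
     half_div g c z e = \int[mu]_x (h x * seval e x)) ->
  \sum_j mev (z j) x0 * g ord0 j <= 0.
Proof.
move=> c g0 nU inth hyp; rewrite leNgt; apply/negP => Z0.
set Z := \sum_j _ in Z0.
pose l := mev (affine_mpoly g c).
have lE x : l x = \sum_j g ord0 j * (x ord0 j - x0 ord0 j).
  rewrite /l mev_affine /c addrC -sumrB; apply: eq_bigr => j _; ring.
have [rho rho0 rhoU] := nbhs_box nU.
pose G := \sum_j g ord0 j ^+ 2.
have G0 : 0 <= G by apply: sumr_ge0 => j _; exact: sqr_ge0.
(* t is small enough for the ball of cap_mpoly to lie in U, s for its cap to lie
   where z.(w + t g) and div z are bounded, and u^-2 >= s^-2 to dominate there *)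
pose t := rho / (4 * (G + 1)).
have t0 : 0 < t by rewrite divr_gt0//; lra.
have tG : 4 * t ^+ 2 * G <= rho ^+ 2 / 4.
  have -> : rho = t * (4 * (G + 1)) by rewrite /t mulfVK// gt_eqF//; lra.
  have H : t ^+ 2 * G <= t ^+ 2 * (G + 1) ^+ 2.
    by rewrite ler_wpM2l ?sqr_ge0//; nra.
  rewrite (_ : _ / 4 = 4 * (t ^+ 2 * (G + 1) ^+ 2)); first by lra.
  by field.
pose Phi x := \sum_j mev (z j) x * (x ord0 j - x0 ord0 j + t * g ord0 j).
pose Div x := \sum_j mev (mderiv j (z j)) x.
have cPhi : continuous Phi.
  apply: continuous_sum_fun => j; apply: continuous_mul_fun; first exact: mev_continuous.
  apply: continuous_add_fun; last exact: continuous_cst_fun.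
  by apply: continuous_add_fun; [exact: coord_continuous|exact: continuous_cst_fun].
have cDiv : continuous Div by apply: continuous_sum_fun => j; exact: mev_continuous.
have Phi0 : Phi x0 = t * Z.
  rewrite /Phi /Z mulr_sumr; apply: eq_bigr => j _; ring.
have Phix0 : t * Z / 2 < Phi x0 by rewrite Phi0; nra.
pose M := Num.max 0 (Div x0 + 1).
have M0 : 0 <= M by rewrite le_max lexx.
have DivM : - M < - Div x0 by rewrite ltrN2 lt_max; apply/orP; right; lra.
have cNDiv : continuous (fun x => - Div x) by move=> x; apply: continuousN; exact: cDiv.
have [r r0 rV] := nbhs_box (filterI (nbhs_gt cPhi Phix0) (nbhs_gt cNDiv DivM)).
have tZ0 : 0 < t * Z / 2 by rewrite divr_gt0// mulr_gt0.
have M1 : 0 < M + 1 by lra.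
pose s := Num.min (Num.min 1 (rho ^+ 2 / 8)) (Num.min (r ^+ 2) (t * Z / 2 / (M + 1))).
have s0 : 0 < s.
  rewrite !lt_min ltr01; apply/andP; split; first by rewrite divr_gt0// exprn_gt0.
  by apply/andP; split; [rewrite exprn_gt0|rewrite divr_gt0].
have s1 : s <= 1 by rewrite !ge_min lexx.
have srho : s <= rho ^+ 2 / 8 by rewrite !ge_min lexx orbT.
have sr : s <= r ^+ 2 by rewrite !ge_min lexx !orbT.
have sM : s * (M + 1) <= t * Z / 2 by rewrite -ler_pdivlMr// !ge_min lexx !orbT.
pose u := mev (cap_mpoly g x0 t s).
have uE x : u x = s - \sum_j (x ord0 j - x0 ord0 j) ^+ 2 - 2 * t * l x.
  rewrite /u mev_cap big_split/= opprD addrA; congr (_ - _).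
  by rewrite lE mulr_sumr; apply: eq_bigr => j _; ring.
have wle x i : (x ord0 i - x0 ord0 i) ^+ 2 <= \sum_j (x ord0 j - x0 ord0 j) ^+ 2.
  by rewrite (bigD1 i)//= lerDl; apply: sumr_ge0 => j _; exact: sqr_ge0.
have wbox x d : 0 < d -> \sum_j (x ord0 j - x0 ord0 j) ^+ 2 < d ^+ 2 ->
    box (fun i => x0 ord0 i - d) (fun i => x0 ord0 i + d) x.
  move=> d0 wd i; have wi := le_lt_trans (wle x i) wd.
  suff : `|x ord0 i - x0 ord0 i| < d by rewrite ltr_norml; lra.
  by rewrite -ltr_sqr ?nnegrE ?normr_ge0 ?ltW// real_normK ?num_real.
pose C := [set x : 'rV[R]_n | 0 <= u x].
have Cbox x : C x -> box (fun i => x0 ord0 i - rho) (fun i => x0 ord0 i + rho) x.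
  rewrite /C /= uE => ux; apply: wbox => //.
  have : 0 <= \sum_j (x ord0 j - x0 ord0 j + 2 * t * g ord0 j) ^+ 2.
    by apply: sumr_ge0 => j _; exact: sqr_ge0.
  rewrite (_ : \sum_j _ = \sum_j (x ord0 j - x0 ord0 j) ^+ 2 + 4 * t * l x + 4 * t ^+ 2 * G).
    by move=> H; nra.
  rewrite lE /G !mulr_sumr -!big_split/=; apply: eq_bigr => j _; ring.
have cC : closed C.
  apply: (@closed_comp _ _ u [set y | 0 <= y]); last exact: closed_ge.
  by move=> x _; exact: mev_continuous.
pose B := rho + \sum_j `|x0 ord0 j|.
have CB : C `<=` cube n B.
  move=> x /Cbox bx i; have := bx i.
  have : `|x0 ord0 i| <= \sum_j `|x0 ord0 j|.
    by rewrite (bigD1 i)//= lerDl; apply: sumr_ge0.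
  rewrite /B; move: (ler_norm (x0 ord0 i)) (ler_norm (- x0 ord0 i)); rewrite normrN.
  by lra.
have CU : C `<=` U by move=> x /Cbox; exact: rhoU.
pose chi := SFlat 1 (SPoly (cap_mpoly g x0 t s)).
have chiC x : ~ C x -> seval chi x = 0.
  by move=> /negP; rewrite -ltNge => ux; rewrite /= flat_exp_le0// ltW.
have T0 : half_div g c z chi = 0.
  apply: (half_div_vanish g0 inth CB chiC) => e' e'C.
  exact: (hyp C B e' cC CB CU).
have GP : 0 < G.
  rewrite lt_neqAle G0 andbT eq_sym; apply: contraNneq g0 => /eqP.
  rewrite psumr_eq0 => [/allP H|j _]; last exact: sqr_ge0.
  apply/eqP/rowP => j; rewrite mxE; apply/eqP.
  by rewrite -sqrf_eq0; apply: H; rewrite mem_index_enum.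
have chiB : bsupp chi B by move=> x nx; apply: chiC => Cx; exact/nx/CB.
pose H := [set x | 0 <= l x].
have neg x : 0 <= l x -> 0 < u x -> field_div z chi x < 0.
  move=> lx ux; rewrite field_div_cap// -/u.
  rewrite pmulr_rlt0 ?flat_exp1_gt0// -/(Div x) -/(Phi x).
  have tl : 0 <= 2 * t * l x by rewrite mulr_ge0// mulr_ge0// ltW.
  have sw : \sum_j (x ord0 j - x0 ord0 j) ^+ 2 < s by move: ux; rewrite uE; lra.
  have [PhiL DivL] := rV x (wbox x r r0 (lt_le_trans sw sr)).
  have us : u x <= s.
    rewrite uE; have : 0 <= \sum_j (x ord0 j - x0 ord0 j) ^+ 2.
      by apply: sumr_ge0 => j _; exact: sqr_ge0.
    by lra.
  rewrite subr_lt0 [_ * _ ^- 2]mulrC -mulrA mulrC ltr_pdivlMr ?exprn_gt0//.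
  rewrite /= in PhiL DivL.
  have uu : u x ^+ 2 <= s by rewrite expr2; nra.
  have : Div x * u x ^+ 2 <= M * u x ^+ 2 by rewrite ler_wpM2r ?sqr_ge0//; lra.
  nra.
have zero x : u x <= 0 -> field_div z chi x = 0.
  move=> ux; rewrite /field_div big1// => j _ /=.
  by rewrite -/(u x) !flat_exp_le0//; ring.
have intf : mu.-integrable setT (EFin \o (fun x => - (\1_H x * field_div z chi x))).
  have := @integrable_sum _ _ _ mu setT measurableT _ (index_enum 'I_n) xpredT
    (fun j => EFin \o (fun x => \1_H x * seval (sderiv j (SMul (SPoly (z j)) chi)) x))
    (fun j _ => half_integrable g c (bsupp_sderiv j (bsupp_mul (z j) chiB))).
  move=> /integrableN; apply: eq_integrable => // x _ /=.
  by rewrite sumEFin EFinN /field_div mulr_sumr.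
have f0 x : 0 <= - (\1_H x * field_div z chi x).
  rewrite oppr_ge0 indicE; have [|] := boolP (x \in H); rewrite ?mul0r// mul1r inE /H/= => lx.
  have [ux|ux] := leP (u x) 0; first by rewrite zero.
  exact/ltW/neg.
have If0 : \int[mu]_x (- (\1_H x * field_div z chi x)) = 0.
  under eq_Rintegral do rewrite -mulN1r.
  rewrite RintegralZl//; first by rewrite (_ : \int[mu]_x _ = half_div g c z chi) ?T0 ?mulr0.
  move/integrableN : intf; apply: eq_integrable => // x _ /=.
  by rewrite opprK.
(* a point of the open cap, where the integrand does not vanish *)
pose eta := Num.min 1 (s / 2 / (G + 2 * t * G)).
have K0 : 0 < G + 2 * t * G by rewrite addr_gt0// mulr_gt0// mulr_gt0.
have eta0 : 0 < eta by rewrite lt_min ltr01 divr_gt0// divr_gt0.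
have eta1 : eta <= 1 by rewrite ge_min lexx.
have etas : eta * (G + 2 * t * G) <= s / 2 by rewrite -ler_pdivlMr// ge_min lexx orbT.
pose p := x0 + eta *: g.
have lp : l p = eta * G.
  rewrite lE /G mulr_sumr; apply: eq_bigr => j _; rewrite !mxE; ring.
have up : u p = s - eta ^+ 2 * G - 2 * t * (eta * G).
  rewrite uE lp; congr (_ - _ - _).
  rewrite /G mulr_sumr; apply: eq_bigr => j _; rewrite !mxE; ring.
have lp0 : 0 < l p by rewrite lp mulr_gt0.
have up0 : 0 < u p.
  have : eta ^+ 2 * G <= eta * G by rewrite ler_wpM2r// expr2; nra.
  by rewrite up; lra.
have [x [lx ux] fx] := integral_eq0_nbhs f0 intf If0
  (filterI (nbhs_gt (@mev_continuous _ _ _) lp0) (nbhs_gt (@mev_continuous _ _ _) up0)).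
move: fx; rewrite indicE mem_set ?mul1r; last by rewrite /H/=; exact/ltW.
by have := neg x (ltW lx) ux; lra.
Qed.

End normal_component.

(** * Normal continuity of fields with square-integrable divergence *)

Section flux.
Variables (R : realType) (n : nat).
Notation mu := (lebesgue_rV R n).
Implicit Types (x : 'rV[R]_n) (e : smooth_expr R n) (D : set 'rV[R]_n).

Lemma field_divN z e x : field_div (fun j => - z j) e x = - field_div z e x.
Proof.
rewrite /field_div -sumrN; apply: eq_bigr => j _ /=.
by rewrite mderivN /mev !mevalN; ring.
Qed.

Lemma half_field_div_integrable (g : 'rV[R]_n) c z e B : bsupp e B ->
  mu.-integrable setT
    (EFin \o (fun x => \1_[set x | 0 <= mev (affine_mpoly g c) x] x * field_div z e x)).
Proof.
move=> eB.
have := @integrable_sum _ _ _ mu setT measurableT _ (index_enum 'I_n) xpredT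
  (fun j => EFin \o (fun x => \1_[set x | 0 <= mev (affine_mpoly g c) x] x *
     seval (sderiv j (SMul (SPoly (z j)) e)) x))
  (fun j _ => half_integrable g c (bsupp_sderiv j (bsupp_mul (z j) eB))).
by apply: eq_integrable => // x _ /=; rewrite sumEFin /field_div mulr_sumr.
Qed.

Lemma field_div_integrable z e B : bsupp e B -> mu.-integrable setT (EFin \o field_div z e).
Proof.
move=> eB.
have := @integrable_sum _ _ _ mu setT measurableT _ (index_enum 'I_n) xpredT
  (fun j => EFin \o seval (sderiv j (SMul (SPoly (z j)) e)))
  (fun j _ => bsupp_integrable (bsupp_sderiv j (bsupp_mul (z j) eB))).
by apply: eq_integrable => // x _ /=; rewrite sumEFin.
Qed.

Lemma integral_field_div z e B : bsupp e B -> \int[mu]_x field_div z e x = 0.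
Proof.
move=> eB; rewrite Rintegral_sum => [|j].
  by rewrite big1// => j _; exact: integral_sderiv (bsupp_mul (z j) eB).
exact: bsupp_integrable (bsupp_sderiv j (bsupp_mul (z j) eB)).
Qed.

Lemma normal_component_eq0 (g x0 : 'rV[R]_n) z (h : 'rV[R]_n -> R) (U : set 'rV[R]_n) :
  let c := - \sum_j g ord0 j * x0 ord0 j in
  g != 0 -> nbhs x0 U -> mu.-integrable setT (EFin \o h) ->
  (forall C B e, closed C -> C `<=` cube n B -> C `<=` U ->
     (forall x, ~ C x -> seval e x = 0) ->
     half_div g c z e = \int[mu]_x (h x * seval e x)) ->
  \sum_j mev (z j) x0 * g ord0 j = 0.
Proof.
move=> c g0 nU inth hyp; apply/eqP; rewrite eq_le (normal_component_le0 g0 nU inth hyp)/=.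
have inthN : mu.-integrable setT (EFin \o (fun x => - h x)).
  by move/integrableN : inth; apply: eq_integrable.
have := @normal_component_le0 _ _ g x0 (fun j => - z j) (fun x => - h x) U g0 nU inthN.
rewrite (_ : \sum_j mev (- z j) x0 * g ord0 j = - \sum_j mev (z j) x0 * g ord0 j).
  rewrite oppr_le0; apply => C B e cC CB CU eC.
  have eB : bsupp e B by move=> x nx; apply: eC => Cx; exact/nx/CB.
  have [M HM] := bsupp_bounded eB.
  have TN : half_div g c (fun j => - z j) e = - half_div g c z e.
    rewrite /half_div -mulN1r -RintegralZl//; last first.
      exact: half_field_div_integrable eB.
    by apply: eq_Rintegral => x _; rewrite field_divN; ring.
  rewrite TN (hyp C B e)// -mulN1r -RintegralZl//.
    by apply: eq_Rintegral => x _; ring.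
  have mh : measurable_fun setT h by apply/measurable_EFinP; exact: measurable_int inth.
  apply: (le_integrable measurableT _ _ (g := fun x => (M%:E * (h x)%:E)%E)) => //.
  - by apply/measurable_EFinP; apply: measurable_funM => //; exact: measurable_seval.
  - move=> x _ /=; rewrite lee_fin !normrM mulrC ler_wpM2r//.
    by rewrite (le_trans (HM x))// ler_norm.
  - exact: integrableZl.
by rewrite -sumrN; apply: eq_bigr => j _; rewrite /mev mevalN mulNr.
Qed.

Lemma integrable_mul_bounded D (f b : 'rV[R]_n -> R) M : measurable D ->
  mu.-integrable D (EFin \o f) -> measurable_fun D b -> (forall x, `|b x| <= M) ->
  mu.-integrable D (EFin \o (fun x => f x * b x)).
Proof.
move=> mD intf mb bM.
have mf : measurable_fun D f by apply/measurable_EFinP; exact: measurable_int intf.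
apply: (le_integrable mD _ _ (g := fun x => (M%:E * (f x)%:E)%E)) => //.
- by apply/measurable_EFinP; exact: measurable_funM.
- move=> x _ /=; rewrite lee_fin !normrM mulrC ler_wpM2r//.
  by rewrite (le_trans (bM x))// ler_norm.
- exact: integrableZl.
Qed.

Lemma lebesgue_bounded D B : measurable D -> D `<=` cube n B -> (mu D < +oo)%E.
Proof.
move=> mD DB; apply: le_lt_trans (lebesgue_cube_lty n B).
by apply: le_measure; rewrite ?inE//; exact: measurable_box.
Qed.

Lemma square_integrable_integrable D f B : measurable D -> D `<=` cube n B ->
  square_integrable D f -> mu.-integrable D (EFin \o f).
Proof.
move=> mD DB [mf f2].
have i2 : mu.-integrable D (EFin \o (fun x => f x ^+ 2)).
  apply/integrableP; split.
    by apply/measurable_EFinP; exact: measurable_funX.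
  by under eq_integral do rewrite gee0_abs ?lee_fin ?sqr_ge0//.
have i1 : mu.-integrable D (EFin \o (cst 1 : 'rV[R]_n -> R)).
  apply: measurable_bounded_integrable => //.
  - exact: lebesgue_bounded DB.
  - exists 1; split; first exact: num_real.
    by move=> N N1 x _ /=; rewrite normr1 ltW.
apply: (le_integrable mD _ _ (g := fun x => ((f x ^+ 2)%:E + 1%:E)%E)) => //.
- exact/measurable_EFinP.
- move=> x _ /=; rewrite lee_fin [leRHS]ger0_norm; last first.
    by have := sqr_ge0 (f x); lra.
  have : `|f x| ^+ 2 = f x ^+ 2 by rewrite real_normK ?num_real.
  by have := sqr_ge0 (`|f x| - 1); have := normr_ge0 (f x); nra.
- exact: integrableD.
Qed.

Lemma test_function_seval D U C B e : open U -> U `<=` D -> closed C ->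
  C `<=` cube n B -> C `<=` U -> (forall x, ~ C x -> seval e x = 0) ->
  test_function (interior D) (seval e).
Proof.
move=> oU UD cC CB CU eC.
have sC : closure [set x | seval e x != 0] `<=` C.
  rewrite [X in _ `<=` X]((closure_id C).1 cC); apply: closure_subset => x /= ex.
  by apply: contrapT => /eC e0; rewrite e0 eqxx in ex.
split; first by move=> k; exact: Ck_seval.
  apply: (@subclosed_compact _ _ [set v : 'rV[R]_n | forall i, v ord0 i \in `[(- B), B]]).
  - exact: closed_closure.
  - apply: (@rV_compact _  _ (fun=> `[(- B), B]%classic)).
    by move=> _; exact: segment_compact.
  - move=> x /sC /CB cx i; rewrite in_itv/=.
    by have /andP[/ltW -> /ltW ->] := cx i.
by move=> x /sC /CU Ux; apply: filterS UD _; exact: open_nbhs_nbhs.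
Qed.

(** Near x0 the row i of tau is p' plus the indicator of the half-space times
p - p'.  The integral of div(e p') over the whole space is zero, so that the
definition of the weak divergence expresses the half-space integral of
div(e (p - p')) by an integrable density. *)
Lemma Hdiv_normal_continuous D U B tau (g x0 : 'rV[R]_n) i
    (p p' : 'I_n -> mpoly n R) :
  let l x := \sum_j g ord0 j * (x ord0 j - x0 ord0 j) in
  measurable D -> D `<=` cube n B -> Hdiv D tau -> g != 0 ->
  open U -> U `<=` D -> U x0 ->
  {ae mu, forall x, U x -> forall j,
     tau x i j = if 0 <= l x then mev (p j) x else mev (p' j) x} ->
  \sum_j mev (p j - p' j) x0 * g ord0 j = 0.
Proof.
move=> l mD DB [_ sqtau [gd sqgd wd]] g0 oU UD Ux0 aetau.
pose c := - \sum_j g ord0 j * x0 ord0 j.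
pose H := [set x | 0 <= mev (affine_mpoly g c) x].
have lE x : mev (affine_mpoly g c) x = l x.
  by rewrite mev_affine /c addrC -sumrB; apply: eq_bigr => j _; ring.
pose k x := \1_H x * (\sum_j mev (mderiv j (p j - p' j)) x) +
            \sum_j mev (mderiv j (p' j)) x.
pose h x := k x - gd x ord0 i.
have mk : measurable_fun setT k.
  apply: measurable_funD.
    apply: measurable_funM.
      by apply: measurable_indic; exact: measurable_half.
    by apply: measurable_sum => j; exact: measurable_mev.
  by apply: measurable_sum => j; exact: measurable_mev.
have intD (f : 'rV[R]_n -> R) M : measurable_fun setT f ->
    (forall x, cube n B x -> `|f x| <= M) -> mu.-integrable D (EFin \o f).
  move=> mf fM; apply: measurable_bounded_integrable => //.
  - exact: lebesgue_bounded DB.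
  - exact: measurable_funTS.
  - exists M; split; first exact: num_real.
    by move=> N MN x Dx /=; rewrite (le_trans _ (ltW MN))// fM//; exact: DB.
have intk : mu.-integrable D (EFin \o k).
  have cs (q : 'I_n -> mpoly n R) : continuous (fun x => \sum_j mev (mderiv j (q j)) x).
    by apply: continuous_sum_fun => j; exact: mev_continuous.
  have [M1 HM1] := continuous_bounded_cube B (cs (fun j => p j - p' j)).
  have [M2 HM2] := continuous_bounded_cube B (cs p').
  apply: (intD k (M1 + M2)) => // x cx; rewrite /k.
  rewrite (le_trans (ler_normD _ _))// lerD ?HM2// normrM (le_trans _ (HM1 x cx))//.
  by rewrite ler_piMl// indicE; case: (_ \in _); rewrite ?normr1 ?normr0.
have intg : mu.-integrable D (EFin \o (fun x => gd x ord0 i)).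
  by apply: square_integrable_integrable DB _.
have inth : mu.-integrable D (EFin \o h).
  by move: (integrableB mD intk intg); apply: eq_integrable.
have inthD : mu.-integrable setT (EFin \o (h \_ D)).
  have := inth; rewrite (integrable_mkcond (EFin \o h) mD).
  by apply: eq_integrable => // x _; rewrite /= !patchE; case: ifP.
have nU : nbhs x0 U by exact: open_nbhs_nbhs.
apply: (normal_component_eq0 g0 nU inthD) => C b e cC Cb CU eC.
have eb : bsupp e b by move=> x nx; apply: eC => Cx; exact/nx/Cb.
have eU x : ~ U x -> seval e x = 0 by move=> nx; apply: eC => /CU.
have dU j x : ~ C x -> seval (sderiv j e) x = 0.
  move=> nCx; apply: (@sderiv_open0 _ _ e j (~` C)) => //.
  exact: closed_openC.
have [M HM] := bsupp_bounded eb.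
have wde := wd i (seval e) (test_function_seval oU UD cC Cb CU eC).
pose z j := p j - p' j.
pose G x := \1_H x * field_div z e x + field_div p' e x.
pose F x := (\sum_j tau x i j * seval (sderiv j e) x) + k x * seval e x.
(* adding div(e p') does not change the integral; almost everywhere the sum is
   tau.grad e + k e *)
have E1 : half_div g c z e = \int[mu]_x G x.
  rewrite /G RintegralD//; last 2 first.
  - exact: half_field_div_integrable eb.
  - exact: field_div_integrable eb.
  by rewrite (integral_field_div p' eb) addr0.
have G0 x : ~ C x -> G x = 0.
  move=> nC; rewrite /G /field_div big1 => [|j _ /=]; last by rewrite eC// dU//; ring.
  by rewrite mulr0 add0r big1// => j _ /=; rewrite eC// dU//; ring.
have F0 x : ~ C x -> F x = 0.
  move=> nC; rewrite /F eC// mulr0 addr0 big1// => j _.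
  by rewrite dU// mulr0.
have GF : {ae mu, forall x, D x -> G x = F x}.
  apply: filterS aetau => x ae_x Dx.
  have [Cx|nCx] := pselect (C x); last by rewrite G0// F0.
  have {}ae_x := ae_x (CU _ Cx).
  rewrite /G /F /k /field_div indicE (_ : (x \in H) = (0 <= l x)); last first.
    by apply/idP/idP; rewrite inE /H/= lE.
  rewrite mulrDl !mulr_sumr !mulr_suml -!big_split/=; apply: eq_bigr => j _.
  rewrite ae_x /z /= mderivB /mev !mevalB.
  by case: ifP => _; rewrite ?mul1r ?mul0r; ring.
have intGD : mu.-integrable D (EFin \o G).
  apply: (integrableS measurableT) => //.
  have := integrableD measurableT (half_field_div_integrable g c z eb) (field_div_integrable p' eb).
  by apply: eq_integrable.
have intke : mu.-integrable D (EFin \o (fun x => k x * seval e x)).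
  by apply: integrable_mul_bounded HM => //; apply: measurable_funTS; exact: measurable_seval.
have intge : mu.-integrable D (EFin \o (fun x => gd x ord0 i * seval e x)).
  by apply: integrable_mul_bounded HM => //; apply: measurable_funTS; exact: measurable_seval.
have intte : mu.-integrable D (EFin \o (fun x => \sum_j tau x i j * seval (sderiv j e) x)).
  have H1 j : mu.-integrable D (EFin \o (fun x => tau x i j * seval (sderiv j e) x)).
    have [M' HM'] := bsupp_bounded (bsupp_sderiv j eb).
    apply: integrable_mul_bounded HM' => //.
      exact: square_integrable_integrable DB (sqtau i j).
    by apply: measurable_funTS; exact: measurable_seval.
  have := @integrable_sum _ _ _ mu D mD _ (index_enum 'I_n) xpredT _ (fun j _ => H1 j).
  by apply: eq_integrable => // x _ /=; rewrite sumEFin.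
have intF : mu.-integrable D (EFin \o F).
  by have := integrableD mD intte intke; apply: eq_integrable.
rewrite E1 (_ : \int[mu]_x G x = \int[mu]_(x in D) G x); last first.
  rewrite [RHS]Rintegral_mkcond; apply: eq_Rintegral => x _.
  rewrite patchE; case: ifPn => // /negP nD; apply: G0 => Cx; apply: nD.
  by rewrite inE; exact/UD/CU.
have -> : \int[mu]_(x in D) G x = \int[mu]_(x in D) F x.
  rewrite /Rintegral; congr fine; apply: ae_eq_integral => //.
  - exact: measurable_int intGD.
  - exact: measurable_int intF.
  - by apply: filterS GF => x GFx /GFx /= ->.
rewrite [in LHS]/F RintegralD//.
have -> : \int[mu]_(x in D) (\sum_j tau x i j * seval (sderiv j e) x) =
         - \int[mu]_(x in D) (gd x ord0 i * seval e x).
  rewrite -wde; apply: eq_Rintegral => x _; apply: eq_bigr => j _.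
  by rewrite partial_seval.
rewrite addrC -RintegralB//.
transitivity (\int[mu]_(x in D) (h x * seval e x)).
  by apply: eq_Rintegral => x _; rewrite /h; ring.
rewrite Rintegral_mkcond; apply: eq_Rintegral => x _.
by rewrite !patchE; case: ifP => _; rewrite ?mul0r.
Qed.

End flux.

(** * Barycentric coordinates *)

Lemma sum_option (V : nmodType) (I : finType) (F : option I -> V) :
  \sum_o F o = F None + \sum_i F (Some i).
Proof.
rewrite (bigD1 None)//=; congr (_ + _).
by rewrite (@reindex_omap _ _ _ _ _ Some id) => [|[i|]]//; apply: eq_bigl => i; rewrite eqxx.
Qed.

Section dot_facts.
Variables (R : realType) (n : nat).
Implicit Types (x y u v : 'rV[R]_n).

Lemma dotE x y : dot x y = \sum_i x ord0 i * y ord0 i.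
Proof. by rewrite /dot mxE; apply: eq_bigr => i _; rewrite mxE. Qed.

Lemma dotC x y : dot x y = dot y x.
Proof. by rewrite !dotE; apply: eq_bigr => i _; rewrite mulrC. Qed.

Lemma dotDl x y v : dot (x + y) v = dot x v + dot y v.
Proof. by rewrite /dot mulmxDl mxE. Qed.

Lemma dotNl x v : dot (- x) v = - dot x v.
Proof. by rewrite /dot mulNmx mxE. Qed.

Lemma dotBl x y v : dot (x - y) v = dot x v - dot y v.
Proof. by rewrite dotDl dotNl. Qed.

Lemma dotZl (c : R) x v : dot (c *: x) v = c * dot x v.
Proof. by rewrite /dot -scalemxAl mxE. Qed.

Lemma dot_suml I (r : seq I) (F : I -> 'rV[R]_n) v :
  dot (\sum_(i <- r) F i) v = \sum_(i <- r) dot (F i) v.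
Proof. by rewrite /dot mulmx_suml summxE. Qed.

Lemma dotDr x y v : dot v (x + y) = dot v x + dot v y.
Proof. by rewrite dotC dotDl !(dotC v). Qed.

Lemma dotBr x y v : dot v (x - y) = dot v x - dot v y.
Proof. by rewrite dotC dotBl !(dotC v). Qed.

Lemma dotZr (c : R) x v : dot v (c *: x) = c * dot v x.
Proof. by rewrite dotC dotZl (dotC v). Qed.

Lemma dot_sumr I (r : seq I) (F : I -> 'rV[R]_n) v :
  dot v (\sum_(i <- r) F i) = \sum_(i <- r) dot v (F i).
Proof. by rewrite dotC dot_suml; apply: eq_bigr => i _; rewrite dotC. Qed.

Lemma dot_eq0 x : (dot x x == 0) = (x == 0).
Proof.
apply/eqP/eqP => [|->]; last by rewrite /dot mul0mx mxE.
rewrite dotE => /eqP; rewrite psumr_eq0 => [/allP H|i _]; last exact: sqr_ge0.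
apply/rowP => i; rewrite mxE; apply/eqP.
by rewrite -sqrf_eq0 expr2; apply: H; rewrite mem_index_enum.
Qed.

Lemma dot_ge0 x : 0 <= dot x x.
Proof. by rewrite dotE; apply: sumr_ge0 => i _; rewrite -expr2 sqr_ge0. Qed.

Lemma dot_inj (u v : 'rV[R]_n) : (forall w, dot u w = dot v w) -> u = v.
Proof.
move=> uv; apply/eqP; rewrite -subr_eq0 -dot_eq0.
by rewrite dotBl uv subrr.
Qed.

Lemma mxappE (M : 'M[R]_n) v : mxapp M v = v *m M^T.
Proof. by rewrite /mxapp trmx_mul trmxK. Qed.

Lemma dot_mxapp_sym (M : 'M[R]_n) u v : M^T = M ->
  dot (mxapp M u) v = dot u (mxapp M v).
Proof. by move=> MT; rewrite !mxappE /dot trmx_mul trmxK MT mulmxA. Qed.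

End dot_facts.

Lemma hull_vertex (R : realType) n (I : finType) (v : I -> 'rV[R]_n) i :
  hull v (v i).
Proof.
exists (fun j => (j == i)%:R); split=> [j||]; first exact: ler0n.
  by rewrite (bigD1 i)//= eqxx big1 ?addr0// => j /negPf ->.
rewrite (bigD1 i)//= eqxx scale1r big1 ?addr0// => j /negPf ->.
by rewrite scale0r.
Qed.

Section barycentric.
Variables (R : realType) (n : nat).
Variables (a : 'rV[R]_n) (b : 'I_n -> 'rV[R]_n).
Hypothesis indep : affinely_independent (cone a b).
Implicit Types x y : 'rV[R]_n.

Let M : 'M[R]_n := \matrix_j (b j - a).

Lemma mulmx_edges (c : 'rV[R]_n) : c *m M = \sum_j c ord0 j *: (b j - a).
Proof. by rewrite mulmx_sum_row; apply: eq_bigr => j _; rewrite rowK. Qed.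

Lemma edges_unit : M \in unitmx.
Proof.
rewrite -row_free_unit; apply: inj_row_free => c; rewrite mulmx_edges => c0.
pose w := oapp (fun j => c ord0 j) (- \sum_j c ord0 j).
have w0 : \sum_i w i = 0 by rewrite sum_option /= addNr.
have wv : \sum_i w i *: cone a b i = 0.
  rewrite sum_option /= scaleNr scaler_suml addrC -sumrB -[RHS]c0.
  by apply: eq_bigr => j _; rewrite scalerBr.
by apply/rowP => j; rewrite mxE; exact: (indep w0 wv (Some j)).
Qed.

(** As the edges b j - a form a basis, bary x j is the barycentric coordinate of x
at b j and bary0 x the one at a; grad and grad0 are their gradients. *)
Definition bary x (j : 'I_n) : R := ((x - a) *m invmx M) ord0 j.
Definition bary0 x : R := 1 - \sum_j bary x j.
Definition grad j : 'rV[R]_n := (col j (invmx M))^T.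
Definition grad0 : 'rV[R]_n := - \sum_j grad j.

Lemma baryE x j : bary x j = dot (grad j) (x - a).
Proof.
rewrite dotE /bary mxE; apply: eq_bigr => i _.
by rewrite mulrC /grad !mxE.
Qed.

Lemma baryB x y j : bary x j - bary y j = dot (grad j) (x - y).
Proof. by rewrite !baryE -dotBr; congr dot; rewrite opprB addrA subrK. Qed.

Lemma bary0B x y : bary0 x - bary0 y = dot grad0 (x - y).
Proof.
rewrite /bary0 dotNl dot_suml.
have -> : \sum_j dot (grad j) (x - y) = \sum_j bary x j - \sum_j bary y j.
  by rewrite -sumrB; apply: eq_bigr => j _; rewrite baryB.
by ring.
Qed.

Lemma bary_comb (c : 'I_n -> R) j : bary (a + \sum_i c i *: (b i - a)) j = c j.
Proof.
rewrite /bary addrC addKr.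
have -> : \sum_i c i *: (b i - a) = (\row_i c i) *m M.
  by rewrite mulmx_edges; apply: eq_bigr => i _; rewrite mxE.
by rewrite mulmxK ?edges_unit// mxE.
Qed.

Lemma bary_decomp x : x = a + \sum_j bary x j *: (b j - a).
Proof. by rewrite -mulmx_edges mulmxKV ?edges_unit// addrC subrK. Qed.

Lemma bary_affine (I : finType) (w : I -> R) (v : I -> 'rV[R]_n) j :
  \sum_i w i = 1 -> bary (\sum_i w i *: v i) j = \sum_i w i * bary (v i) j.
Proof.
move=> w1; rewrite baryE (_ : _ - a = \sum_i w i *: (v i - a)).
  by rewrite dot_sumr; apply: eq_bigr => i _; rewrite dotZr -baryE.
rewrite -[X in _ - X]scale1r -w1 scaler_suml -sumrB.
by apply: eq_bigr => i _; rewrite scalerBr.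
Qed.

Lemma bary_a j : bary a j = 0.
Proof. by rewrite /bary subrr mul0mx mxE. Qed.

Lemma bary_b i j : bary (b i) j = (i == j)%:R.
Proof.
have -> : b i = a + \sum_k (k == i)%:R *: (b k - a).
  rewrite (bigD1 i)//= eqxx scale1r big1 => [|k /negPf ->]; last by rewrite scale0r.
  by rewrite addr0 addrC subrK.
by rewrite bary_comb eq_sym.
Qed.

Lemma bary0_decomp x : x = bary0 x *: a + \sum_j bary x j *: b j.
Proof.
rewrite {1}(bary_decomp x) /bary0 scalerBl scale1r -addrA; congr (_ + _).
by rewrite scaler_suml addrC -sumrB; apply: eq_bigr => j _; rewrite scalerBr.
Qed.

Lemma bary_cone_sum (w : option 'I_n -> R) j : \sum_i w i = 1 ->
  bary (\sum_i w i *: cone a b i) j = w (Some j).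
Proof.
move=> w1; rewrite bary_affine// sum_option /= bary_a mulr0 add0r.
rewrite (bigD1 j)//= bary_b eqxx mulr1 big1 ?addr0// => i /negPf ij.
by rewrite bary_b ij mulr0.
Qed.

Lemma hull_coneP x :
  hull (cone a b) x <-> (forall j, 0 <= bary x j) /\ 0 <= bary0 x.
Proof.
split=> [[w [w0 w1 ->]]|[x0 x1]].
  split=> [j|]; first by rewrite bary_cone_sum.
  rewrite /bary0 (eq_bigr (fun j => w (Some j))) => [|j _].
    by rewrite -w1 sum_option addrK.
  exact: bary_cone_sum.
exists (oapp (bary x) (bary0 x)); split; first by case.
  by rewrite sum_option /= /bary0 subrK.
by rewrite sum_option /= -bary0_decomp.
Qed.

Lemma bary_b_sum (w : 'I_n -> R) j : \sum_i w i = 1 ->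
  bary (\sum_i w i *: b i) j = w j.
Proof.
move=> w1; rewrite bary_affine//.
rewrite (bigD1 j)//= bary_b eqxx mulr1 big1 ?addr0// => i /negPf ij.
by rewrite bary_b ij mulr0.
Qed.

Lemma hull_baseP x :
  hull b x <-> (forall j, 0 <= bary x j) /\ bary0 x = 0.
Proof.
split=> [[w [w0 w1 ->]]|[x0 x1]].
  split=> [j|]; first by rewrite bary_b_sum.
  rewrite /bary0 (eq_bigr w) => [|j _]; first by rewrite w1 subrr.
  exact: bary_b_sum.
exists (bary x); split=> //.
  by move/eqP: x1; rewrite subr_eq0 => /eqP.
by rewrite {1}(bary0_decomp x) x1 scale0r add0r.
Qed.

Lemma hull_faceP j x :
  hull (cone a (subfamily (predC1 j) b)) x <->
  [/\ forall i, 0 <= bary x i, 0 <= bary0 x & bary x j = 0].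
Proof.
have sub_sum (V : nmodType) (F : 'I_n -> V) :
    \sum_(i : {i | predC1 j i}) F (val i) = \sum_(i | i != j) F i.
  by have := big_sub (predC1 j) F; move=> <-.
split=> [[w [w0 w1 ->]]|[x0 x1 xj]].
  have [w' [w'N wS w'j w'0]] : exists w' : option 'I_n -> R,
      [/\ w' None = w None, forall i : {i | predC1 j i}, w' (Some (val i)) = w (Some i),
          w' (Some j) = 0 & forall i, 0 <= w' i].
    exists (oapp (fun i => oapp (fun k => w (Some k)) 0 (insub i)) (w None)).
    split=> [//|i /=|/=|[i|]//=]; first by rewrite valK.
      by rewrite insubF//= eqxx.
    by case: insubP => //= k _ _; exact: w0.
  have w'1 : \sum_i w' i = 1.
    rewrite -w1 !sum_option w'N; congr (_ + _).
    rewrite (bigD1 j)//= w'j add0r -(sub_sum _ (fun i => w' (Some i))).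
    by apply: eq_bigr => i _; exact: wS.
  have -> : \sum_i w i *: cone a (subfamily (predC1 j) b) i =
            \sum_i w' i *: cone a b i.
    rewrite !sum_option w'N; congr (_ + _).
    rewrite [RHS](bigD1 j)//= w'j scale0r add0r.
    rewrite -(sub_sum _ (fun i => w' (Some i) *: b i)).
    by apply: eq_bigr => i _; rewrite wS.
  have [H0 H1] : (forall i, 0 <= bary (\sum_i w' i *: cone a b i) i) /\
      0 <= bary0 (\sum_i w' i *: cone a b i).
    by apply/hull_coneP; exists w'; split.
  by split=> //; rewrite bary_cone_sum.
exists (oapp (fun i => bary x (val i)) (bary0 x)); split.
- by case=> [i|] /=.
- rewrite sum_option /= (sub_sum _ (bary x)) /bary0 (bigD1 j)//= xj add0r.
  by rewrite subrK.
- rewrite sum_option /= (sub_sum _ (fun i => bary x i *: b i)).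
  by rewrite {1}(bary0_decomp x) [in LHS](bigD1 j)//= xj scale0r add0r.
Qed.

Lemma grad_neq0 j : grad j != 0.
Proof.
apply/eqP => g0; have := baryB (b j) a j; rewrite bary_b bary_a eqxx subr0 g0.
by rewrite /dot mul0mx mxE => /eqP; rewrite oner_eq0.
Qed.

Lemma bary0_a : bary0 a = 1.
Proof. by rewrite /bary0 big1 ?subr0// => j _; rewrite bary_a. Qed.

Lemma bary0_b i : bary0 (b i) = 0.
Proof.
rewrite /bary0 (bigD1 i)//= bary_b eqxx big1 ?addr0 ?subrr// => j ij.
by rewrite bary_b eq_sym (negPf ij).
Qed.

Lemma face_normal j (nu := (Num.sqrt (dot (grad j) (grad j)))^-1 *: grad j) :
  unit_normal (hull (cone a (subfamily (predC1 j) b))) nu.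
Proof.
have gg : 0 < dot (grad j) (grad j).
  by rewrite lt_neqAle dot_ge0 andbT eq_sym dot_eq0 grad_neq0.
split=> [|x y /hull_faceP[_ _ xj] /hull_faceP[_ _ yj]].
  rewrite /nu dotZl dotZr mulrA -invfM -expr2 sqr_sqrtr ?ltW//.
  by rewrite mulVf// gt_eqF.
by rewrite /nu dotZl -baryB xj yj subrr mulr0.
Qed.

(** A vector orthogonal to the base is determined by its product with the edges
from a, which is the same for all of them. *)
Lemma base_normal (nu : 'rV[R]_n) : (0 < n)%N -> unit_normal (hull b) nu ->
  exists2 c : R, c != 0 & nu = c *: grad0.
Proof.
move=> n0 [nu1 nuE]; pose i0 := Ordinal n0.
pose c := - dot nu (b i0 - a).
have nc j : dot nu (b j - a) = - c.
  rewrite /c opprK -[LHS](subrK (dot nu (b i0 - a))) -dotBr.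
  rewrite (_ : _ - _ = b j - b i0); first by rewrite nuE ?add0r//; exact: hull_vertex.
  by rewrite opprB addrA subrK.
have nuc : nu = c *: grad0.
  have e1 : nu *m M^T = (c *: grad0) *m M^T.
    apply/rowP => j.
    have rowM (v : 'rV[R]_n) : (v *m M^T) ord0 j = dot v (b j - a).
      by rewrite /dot !mxE; apply: eq_bigr => i _; rewrite !mxE.
    rewrite !rowM nc dotZl -bary0B bary0_b bary0_a sub0r; ring.
  have MTu : M^T \in unitmx by rewrite unitmx_tr edges_unit.
  by rewrite -[nu](mulmxK MTu) e1 mulmxK.
exists c => //; apply: contra_eq_neq nu1 => c0.
by rewrite nuc c0 scale0r /dot mul0mx mxE eq_sym oner_neq0.
Qed.

End barycentric.

(** * Two simplices sharing a face *)

Section two_simplices.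
Variables (R : realType) (n : nat).
Variables (a a' : 'rV[R]_n) (b : 'I_n -> 'rV[R]_n).
Hypothesis hK : affinely_independent (cone a b).
Hypothesis hK' : affinely_independent (cone a' b).
Implicit Types x y : 'rV[R]_n.

Lemma bary_change x j :
  bary a b x j = bary0 a' b x * bary a b a' j + bary a' b x j.
Proof.
rewrite [in LHS](bary0_decomp hK' x).
have -> : bary0 a' b x *: a' + \sum_i bary a' b x i *: b i =
    \sum_o oapp (bary a' b x) (bary0 a' b x) o *: cone a' b o.
  by rewrite sum_option.
rewrite bary_affine; last by rewrite sum_option /= /bary0 subrK.
rewrite sum_option /=; congr (_ + _).
rewrite (bigD1 j)//= bary_b// eqxx mulr1 big1 ?addr0// => i /negPf ij.
by rewrite bary_b// ij mulr0.
Qed.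

Lemma bary0_change x : bary0 a b x = bary0 a' b x * bary0 a b a'.
Proof.
rewrite [LHS]/bary0 (eq_bigr _ (fun j _ => bary_change x j)) big_split/=.
by rewrite -mulr_sumr /bary0; ring.
Qed.

(** The coordinates at b j in the two simplices agree on the common face, so their
gradients differ by a normal vector; the factor is the coordinate of a' at b j. *)
Lemma grad_change j : grad a b j = bary a b a' j *: grad0 a' b + grad a' b j.
Proof.
apply: dot_inj => w; rewrite dotDl dotZl -[w]subr0 -!baryB -bary0B.
by rewrite (bary_change w) (bary_change 0); ring.
Qed.

Lemma grad0_change : grad0 a b = bary0 a b a' *: grad0 a' b.
Proof.
apply: dot_inj => w; rewrite dotZl -[w]subr0 -!bary0B.
by rewrite (bary0_change w) (bary0_change 0); ring.
Qed.

Lemma apex0_neq0 : bary0 a b a' != 0.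
Proof.
have := bary0_change a; rewrite bary0_a => /eqP.
by apply: contraTneq => ->; rewrite mulr0 oner_eq0.
Qed.

Lemma grad0_neq0 : (0 < n)%N -> grad0 a b != 0.
Proof.
move=> n0; apply/eqP => g0.
have := bary0B a b a (b (Ordinal n0)); rewrite bary0_a (bary0_b hK) g0.
by rewrite /dot mul0mx mxE => /eqP; rewrite subr0 oner_eq0.
Qed.

(** If a' were on the same side as a, a point slightly above the barycentre of the
face would belong to both simplices. *)
Lemma apex0_lt0 : (0 < n)%N ->
  hull (cone a b) `&` hull (cone a' b) = hull b -> bary0 a b a' < 0.
Proof.
move=> n0 hF; rewrite lt_neqAle apex0_neq0/= leNgt; apply/negP => al0.
set al := bary0 a b a' in al0.
pose K := \sum_j `|bary a b a' j| / al.
have K0 : 0 <= K by apply: sumr_ge0 => j _; rewrite divr_ge0// ltW.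
have N0 : 0 < n%:R :> R by rewrite ltr0n.
(* a height e for which the common coordinate (1 - e) / n of the other vertices is
   K e, enough to absorb the change of coordinates *)
pose e := (1 + n%:R * K)^-1.
have D0 : 0 < 1 + n%:R * K by have := mulr_ge0 (ltW N0) K0; lra.
have e0 : 0 < e by rewrite invr_gt0.
have ce : (1 - e) / n%:R = K * e by rewrite /e; field; rewrite !gt_eqF.
pose x := a + \sum_i (K * e) *: (b i - a).
have bx j : bary a b x j = K * e by rewrite /x (bary_comb hK (fun=> K * e)).
have b0x : bary0 a b x = e.
  rewrite /bary0 (eq_bigr (fun=> K * e)) => [|j _]; last exact: bx.
  by rewrite sumr_const card_ord -mulr_natr -ce; field; rewrite gt_eqF.
have b0x' : bary0 a' b x = e / al.
  by have := bary0_change x; rewrite b0x -/al => ->; field; rewrite gt_eqF.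
have bx' j : 0 <= bary a' b x j.
  have := bary_change x j; rewrite bx b0x' => /eqP.
  rewrite addrC -subr_eq => /eqP <-.
  have : `|bary a b a' j| / al <= K.
    rewrite /K (bigD1 j)//= lerDl; apply: sumr_ge0 => i _.
    by rewrite divr_ge0// ltW.
  rewrite subr_ge0 => H.
  rewrite (_ : e / al * _ = bary a b a' j / al * e); last first.
    by rewrite mulrAC [e * _]mulrC mulrAC.
  rewrite ler_wpM2r ?(ltW e0)//; apply: le_trans H.
  by rewrite ler_wpM2r ?invr_ge0 ?(ltW al0)// ler_norm.
have : hull b x.
  rewrite -hF; split; apply/hull_coneP => //.
    by split=> [j|]; [rewrite bx mulr_ge0// ltW|rewrite b0x ltW].
  by split=> //; rewrite b0x' divr_ge0// ltW.
by move/(hull_baseP hK) => [_]; rewrite b0x => e00; rewrite e00 ltxx in e0.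
Qed.

(** If the coordinate of a' at b j were zero, the hyperplane through a and the other
vertices b i would contain a' as well. *)
Lemma apex_neq0 j : (1 < n)%N ->
  (forall S : {set 'I_n}, (1 <= #|S| < n)%N ->
      ~ exists A : set 'rV[R]_n,
        [/\ affine_plane #|S| A,
            hull (cone a (subfamily (mem S) b)) `<=` A &
            hull (cone a' (subfamily (mem S) b)) `<=` A]) ->
  bary a b a' j != 0.
Proof.
move=> n1 hplane; apply/eqP => bj.
have cS : #|[set~ j]%SET| = n.-1 by rewrite cardsC1 card_ord.
apply: (hplane [set~ j]%SET); first by rewrite cS ltn_predL (ltnW n1) andbT -ltnS prednK// ltnW.
exists [set x | bary a b x j = 0].
have sub z : bary a b z j = 0 ->
    hull (cone z (subfamily (mem [set~ j]%SET) b)) `<=` [set x | bary a b x j = 0].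
  move=> zj x [w [w0 w1 ->]] /=; rewrite bary_affine// big1// => -[i|] _ /=.
    rewrite /subfamily bary_b// (_ : (val i == j) = false) ?mulr0//.
    by apply/negbTE; have := valP i; rewrite !inE.
  by rewrite zj mulr0.
split; [|exact/sub/bary_a|exact: sub].
exists a, (kermx (grad a b j)^T); split.
  by rewrite mxrank_ker mxrank_tr rank_rV grad_neq0// cS subn1.
apply/seteqP; split=> x /=; rewrite baryE sub_kermx => H.
  by apply/eqP/matrixP => i k; rewrite !ord1 [in RHS]mxE -H dotC /dot.
by rewrite dotC /dot (eqP H) mxE.
Qed.

End two_simplices.

(** * The normal trace of a face bubble *)

Section simplex_topology.
Variables (R : realType) (n : nat).
Variables (a : 'rV[R]_n) (b : 'I_n -> 'rV[R]_n).
Implicit Types x y : 'rV[R]_n.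

Lemma bary_mev j : bary a b ^~ j = mev (affine_mpoly (grad a b j) (- dot (grad a b j) a)).
Proof.
by apply/funext => x; rewrite baryE mev_affine dotBr -dotE addrC.
Qed.

Lemma bary_continuous j : continuous (bary a b ^~ j).
Proof. by rewrite bary_mev; exact: mev_continuous. Qed.

Lemma measurable_bary j : measurable_fun setT (bary a b ^~ j).
Proof. by rewrite bary_mev; exact: measurable_mev. Qed.

Lemma measurable_bary0 : measurable_fun setT (bary0 a b).
Proof.
apply: measurable_funB; first exact: measurable_cst.
by apply: measurable_sum => j; exact: measurable_bary.
Qed.

Lemma measurable_hull : affinely_independent (cone a b) ->
  measurable (hull (cone a b)).
Proof.
move=> indep; rewrite (_ : hull _ =
    [set x | forall j, 0 <= bary a b x j] `&` [set x | 0 <= bary0 a b x]).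
  apply: measurableI; last by apply: measurable_ge0; exact: measurable_bary0.
  by apply: measurable_forall => j; apply: measurable_ge0; exact: measurable_bary.
by apply/seteqP; split=> x /(hull_coneP indep).
Qed.

Lemma hull_bounded (I : finType) (v : I -> 'rV[R]_n) :
  exists B, hull v `<=` cube n B.
Proof.
exists (1 + \sum_j \sum_i `|v j ord0 i|) => _ [w [w0 w1 ->]] i.
rewrite -ltr_norml summxE (le_lt_trans (ler_norm_sum _ _ _))//.
apply: (@le_lt_trans _ _ (\sum_j \sum_i `|v j ord0 i|)); last by rewrite ltrDr.
apply: ler_sum => j _; rewrite mxE normrM.
have wj1 : `|w j| <= 1.
  by rewrite ger0_norm// -w1 (bigD1 j)//= lerDl; apply: sumr_ge0 => k _; exact: w0.
apply: (@le_trans _ _ `|v j ord0 i|); first by rewrite ler_piMl.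
by rewrite (bigD1 i)//= lerDl; apply: sumr_ge0.
Qed.

End simplex_topology.

Lemma cube_mono (R : realType) n (B B' : R) : B <= B' -> cube n B `<=` cube n B'.
Proof. by move=> BB x cx i; have := cx i; lra. Qed.

Lemma continuous_vanish_endpoint (R : realType) (f : R -> R) :
  continuous f -> (forall t, 0 < t -> t <= 1 -> f t = 0) -> f 0 = 0.
Proof.
move=> cf f0; apply/eqP; apply: contrapT => /negP fn0.
have : nbhs (0 : R) [set t | f t != 0].
  apply: open_nbhs_nbhs; split => //.
  apply: (@open_comp _ _ f [set y | y != 0]) => [x _|]; first exact: cf.
  exact: open_neq.
move=> /nbhs_ballP[r /= r0 rf].
have r2 : 0 < Num.min (r / 2) 1 by rewrite lt_min ltr01 divr_gt0.
have : f (Num.min (r / 2) 1) != 0.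
  apply: rf; rewrite /ball/= sub0r normrN gtr0_norm//.
  apply: (@le_lt_trans _ _ (r / 2)); first by rewrite ge_min lexx.
  by rewrite ltr_pdivrMr//; lra.
by rewrite f0 ?eqxx// ge_min lexx orbT.
Qed.

Section face_bubble_trace.
Variables (R : realType) (n : nat).
Hypothesis n1 : (1 < n)%N.
Variables (a a' : 'rV[R]_n) (b : 'I_n -> 'rV[R]_n).
Hypothesis hK : affinely_independent (cone a b).
Hypothesis hK' : affinely_independent (cone a' b).
Hypothesis hF : hull (cone a b) `&` hull (cone a' b) = hull b.
Implicit Types x y : 'rV[R]_n.

Let n0 : (0 < n)%N. Proof. exact: ltnW. Qed.

Section continuity_across.
Variables (tau sigma sigma' : 'rV[R]_n -> 'M[R]_n).
Hypothesis Htau : Hdiv (hull (cone a b) `|` hull (cone a' b)) tau.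
Variables (p p' : 'I_n -> 'I_n -> mpoly n R).
Hypothesis sigmaE : forall i j x, hull (cone a b) x -> sigma x i j = mev (p i j) x.
Hypothesis sigma'E : forall i j x, hull (cone a' b) x -> sigma' x i j = mev (p' i j) x.
Hypothesis tauE : {ae lebesgue_rV R n, forall x, hull (cone a b) x -> tau x = sigma x}.
Hypothesis tau'E : {ae lebesgue_rV R n, forall x, hull (cone a' b) x -> tau x = sigma' x}.

Lemma normal_continuous_interior x0 i : bary0 a b x0 = 0 ->
  (forall j, 0 < bary a b x0 j) ->
  \sum_j mev (p i j - p' i j) x0 * grad0 a b ord0 j = 0.
Proof.
move=> x00 x0p.
have al0 := apex0_lt0 hK hK' n0 hF.
have x00' : bary0 a' b x0 = 0.
  have /eqP := bary0_change hK hK' x0; rewrite x00 eq_sym mulf_eq0.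
  by rewrite (lt_eqF al0) orbF => /eqP.
pose U := [set x | forall j, 0 < bary a b x j /\ 0 < bary a' b x j].
have oU : open U.
  rewrite openE => x Ux; rewrite /interior.
  apply: (@filter_forall 'rV[R]_n 'I_n
    (fun j y => 0 < bary a b y j /\ 0 < bary a' b y j) (nbhs x)) => j.
  have [u1 u2] := Ux j.
  by apply: filterI; apply: nbhs_gt => //; exact: bary_continuous.
have [B1 HB1] := hull_bounded (cone a b).
have [B2 HB2] := hull_bounded (cone a' b).
have lE x : \sum_j grad0 a b ord0 j * (x ord0 j - x0 ord0 j) = bary0 a b x.
  rewrite -[RHS]subr0 -[X in _ - X]x00 bary0B dotE.
   by apply: eq_bigr => j _; rewrite !mxE.
have UK x : U x -> 0 <= bary0 a b x -> hull (cone a b) x.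
  by move=> Ux lx; apply/hull_coneP => //; split=> // j; have [/ltW] := Ux j.
have UK' x : U x -> bary0 a b x <= 0 -> hull (cone a' b) x.
  move=> Ux; rewrite (bary0_change hK hK') => lx.
  apply/hull_coneP => //; split=> [j|]; first by have [_ /ltW] := Ux j.
  by move: lx; rewrite (nmulr_lle0 _ al0).
apply: (@Hdiv_normal_continuous _ _ (hull (cone a b) `|` hull (cone a' b)) U
    (Num.max B1 B2) tau _ _ i) => //.
- by apply: measurableU; exact: measurable_hull.
- move=> x [/HB1|/HB2]; apply: cube_mono; rewrite le_max lexx ?orbT//.
- exact: grad0_neq0.
- move=> x Ux; case: (leP 0 (bary0 a b x)) => [|/ltW] lx; [left; exact: UK|right; exact: UK'].
- move=> j; split => //.
  by have := bary_change hK hK' x0 j; rewrite x00' mul0r add0r => <-.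
- apply: filterS2 tauE tau'E => x t1 t2 Ux j; rewrite lE.
  case: ifPn => [lx|]; first by rewrite t1 ?sigmaE//; exact: UK.
  by rewrite -ltNge => /ltW lx; rewrite t2 ?sigma'E//; exact: UK'.
Qed.

(** From the relative interior of the face to its boundary, along the segment to
the barycentre. *)
Lemma normal_continuous x i : hull b x ->
  \sum_j mev (p i j - p' i j) x * grad0 a b ord0 j = 0.
Proof.
move=> /(hull_baseP hK)[xp x0].
pose y := \sum_(j < n) (n%:R^-1 : R) *: b j.
have N0 : 0 < n%:R :> R by rewrite ltr0n.
have y1 : \sum_(j < n) (n%:R^-1 : R) = 1.
  by rewrite sumr_const card_ord -[LHS]mulr_natr mulVf// gt_eqF.
have yj j : bary a b y j = n%:R^-1 by rewrite /y (bary_b_sum hK).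
have y0 : bary0 a b y = 0.
  by rewrite /bary0 (eq_bigr _ (fun j _ => yj j)) y1 subrr.
pose f (t : R) := \sum_j mev (p i j - p' i j) (t *: (y - x) + x) * grad0 a b ord0 j.
have : f 0 = 0.
  apply: continuous_vanish_endpoint.
    apply: (@continuous_line _ _ (fun y => \sum_j mev (p i j - p' i j) y * grad0 a b ord0 j)).
    apply: continuous_sum_fun => j; apply: continuous_mul_fun; last exact: continuous_cst_fun.
    exact: mev_continuous.
  move=> t t0 t1; apply: normal_continuous_interior.
    have /eqP := bary0B a b (t *: (y - x) + x) x.
    by rewrite addrK dotZr -bary0B y0 x0 !subr0 mulr0 => /eqP.
  move=> j; have /eqP := baryB a b (t *: (y - x) + x) x j.
  rewrite addrK dotZr -baryB yj subr_eq => /eqP ->.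
  have := xp j; have : 0 < (n%:R^-1 : R) by rewrite invr_gt0.
  by move=> c0 xj; nra.
by rewrite /f scale0r add0r.
Qed.

End continuity_across.

(** Let g_j and g'_j be the gradients of the coordinates at b j.  By symmetry of
sigma, sigma g_j = 0 gives (sigma nu).g_j = 0, and on the other side
(sigma nu).g'_j = 0 since sigma nu = sigma' nu.  As g_j - g'_j is a nonzero
multiple of nu, it follows that (sigma nu).nu = 0. *)
Lemma normal_normal_vanish k tau sigma sigma' nuF x j :
  (forall S : {set 'I_n}, (1 <= #|S| < n)%N ->
      ~ exists A : set 'rV[R]_n,
        [/\ affine_plane #|S| A,
            hull (cone a (subfamily (mem S) b)) `<=` A &
            hull (cone a' (subfamily (mem S) b)) `<=` A]) ->
  unit_normal (hull b) nuF ->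
  face_bubble k a a' b tau sigma sigma' ->
  hull b x -> bary a b x j = 0 ->
  dot (mxapp (sigma x) nuF) nuF = 0.
Proof.
move=> hplane hnu [Ht [[symS polS] tE] [[symS' polS'] tE'] z z'] bx xj.
have /choice[p Hp] (ij : 'I_n * 'I_n) : exists q, forall x, hull (cone a b) x ->
    sigma x ij.1 ij.2 = mev q x.
  by have [q _ Hq] := polS ij.1 ij.2; exists q.
have /choice[p' Hp'] (ij : 'I_n * 'I_n) : exists q, forall x, hull (cone a' b) x ->
    sigma' x ij.1 ij.2 = mev q x.
  by have [q _ Hq] := polS' ij.1 ij.2; exists q.
have [Kx K'x] : hull (cone a b) x /\ hull (cone a' b) x by move: bx; rewrite -hF.
have cont : mxapp (sigma x) (grad0 a b) = mxapp (sigma' x) (grad0 a b).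
  apply/rowP => i; apply/eqP; rewrite -subr_eq0.
  have := @normal_continuous tau sigma sigma' Ht (fun i j => p (i, j))
    (fun i j => p' (i, j)) (fun i j => Hp (i, j)) (fun i j => Hp' (i, j)) tE tE' x i bx.
  move=> E; apply/eqP; rewrite -[RHS]E !mxappE !mxE -sumrB; apply: eq_bigr => l _.
  rewrite !mxE (Hp (i, l))// (Hp' (i, l))// /mev mevalB; ring.
have [xp x0] := (hull_baseP hK x).1 bx.
have [xp' x0'] := (hull_baseP hK' x).1 bx.
have xj' : bary a' b x j = 0.
  by have := bary_change hK hK' x j; rewrite x0' mul0r add0r xj.
have face (c : 'rV[R]_n) (s : 'rV[R]_n -> 'M[R]_n) :
    affinely_independent (cone c b) -> zero_normal_off c b s ->
    hull (cone c (subfamily (predC1 j) b)) x -> mxapp (s x) (grad c b j) = 0.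
  move=> hc zc Fx; have := zc j _ (face_normal hc j) x Fx.
  rewrite !mxappE -scalemxAl => /eqP; rewrite scaler_eq0 invr_eq0 sqrtr_eq0.
  rewrite leNgt lt_neqAle dot_ge0 andbT eq_sym dot_eq0 (negPf (grad_neq0 hc j))/=.
  by move/eqP.
have Fx : hull (cone a (subfamily (predC1 j) b)) x.
  by apply/(hull_faceP hK); split; rewrite ?x0.
have Fx' : hull (cone a' (subfamily (predC1 j) b)) x.
  by apply/(hull_faceP hK'); split; rewrite ?x0'.
have s0 := face a sigma hK z Fx.
have s0' := face a' sigma' hK' z' Fx'.
have d1 : dot (mxapp (sigma x) (grad0 a b)) (grad a b j) = 0.
  by rewrite dot_mxapp_sym ?symS// s0 /dot trmx0 mulmx0 mxE.
have d2 : dot (mxapp (sigma x) (grad0 a b)) (grad a' b j) = 0.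
  by rewrite cont dot_mxapp_sym ?symS'// s0' /dot trmx0 mulmx0 mxE.
have be0 := apex_neq0 hK j n1 hplane.
have d3 : dot (mxapp (sigma x) (grad0 a b)) (grad0 a b) = 0.
  move: d1; rewrite (grad_change hK hK') dotDr d2 addr0 dotZr => /eqP.
  rewrite mulf_eq0 (negPf be0)/= => /eqP d1.
  by rewrite [in X in dot _ X](grad0_change hK hK') dotZr d1 mulr0.
have [c _ ->] := base_normal hK n0 hnu.
by rewrite mxappE -scalemxAl -mxappE dotZl dotZr d3 !mulr0.
Qed.

End face_bubble_trace.

(** * Polynomials vanishing on the facets of the standard simplex *)

Section polynomial_vanishing.
Variables (R : realType) (n : nat).
Implicit Types (p q : mpoly n R) (x t : 'rV[R]_n).

Lemma mderiv_eq0_const p : (forall j, mderiv j p = 0) -> p = mpolyC n (mcoeff mnm0 p).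
Proof.
move=> dp; apply/mpolyP => m; rewrite mcoeffC.
have [<-|m0] := eqVneq mnm0 m; first by rewrite mulr1.
rewrite mulr0; have [j mj] : exists j, (0 < m j)%N.
  apply/existsP; apply: contraNT m0 => /existsPn H; apply/eqP/esym/mnmP => j.
  by rewrite mnm0E; apply/eqP; rewrite -leqn0 leqNgt H.
have mE : m = mnm_add (mnm_sub m (mnm1 j)) (mnm1 j).
  apply/mnmP => k; rewrite mnmDE mnmBE mnm1E; case: eqP => [<-|_] /=.
    by rewrite subnK.
  by rewrite subn0 addn0.
have := mcoeff_mderiv j p (mnm_sub m (mnm1 j)).
rewrite -mE dp mcoeff0 => /esym/eqP.
by rewrite mulrn_eq0 => /eqP.
Qed.

Lemma msize_mderiv j p d : (msize p <= d.+1)%N -> (msize (mderiv j p) <= d)%N.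
Proof.
move=> pd; rewrite msizeE; apply/bigmax_leqP_seq => m.
rewrite mcoeff_msupp mcoeff_mderiv => H _.
have : (mdeg (mnm_add m (mnm1 j)) < msize p)%N.
  apply: msize_mdeg_lt; rewrite mcoeff_msupp; apply: contraNneq H => ->.
  by rewrite mul0rn.
rewrite mdegD mdeg1 addn1 => /leq_trans/(_ pd).
by rewrite ltnS.
Qed.

(** Induction on the degree: the partial derivatives vanish on V too. *)
Lemma mpoly_vanish_open p (V : set 'rV[R]_n) x : open V -> V x ->
  (forall y, V y -> mev p y = 0) -> p = 0.
Proof.
move=> oV Vx; have [d] := ubnP (msize p); elim: d p => // d IH p; rewrite ltnS => pd p0.
case: d => [|d] in IH pd *.
  by apply/eqP; rewrite -msize_poly_eq0 -leqn0.
have dp j : mderiv j p = 0.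
  apply: IH => [|y Vy]; first by rewrite ltnS; exact: msize_mderiv.
  by have := @sderiv_open0 R n (SPoly p) j V oV p0 y Vy.
have pC := mderiv_eq0_const dp; have := p0 x Vx.
by rewrite pC mevC => ->; rewrite mpolyC0.
Qed.

Definition open_simplex : set 'rV[R]_n :=
  [set t | (forall i, 0 < t ord0 i) /\ \sum_i t ord0 i < 1].

Lemma open_open_simplex : open open_simplex.
Proof.
apply: openI.
  rewrite openE => x xp; rewrite /interior.
  apply: (@filter_forall 'rV[R]_n 'I_n (fun j y => 0 < y ord0 j) (nbhs x)) => j.
  apply: (@nbhs_gt R 'rV[R]_n (fun y => y ord0 j)) (xp j).
  exact: coord_continuous.
rewrite (_ : (fun x : 'rV[R]_n => _) =
    (fun x : 'rV[R]_n => \sum_i x ord0 i) @^-1` [set y | y < 1])//.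
apply: open_comp; last exact: open_lt.
by move=> x _; move: x; apply: continuous_sum_fun => i; exact: coord_continuous.
Qed.

Lemma open_simplex_center : open_simplex (const_mx (n.+1%:R^-1)).
Proof.
split=> [i|]; first by rewrite mxE invr_gt0.
under eq_bigr do rewrite mxE.
by rewrite sumr_const card_ord -[X in X < _]mulr_natl ltr_pdivrMr// mul1r ltr_nat.
Qed.

Lemma open_simplex_sub : open_simplex `<=` @std_simplex R n.
Proof. by move=> t [t0 t1]; split=> [i|]; exact: ltW. Qed.

(** The monomials free of the i-th variable form a polynomial that depends on the
other variables only, and vanishes on the open simplex. *)
Lemma facet_vanish_msupp p i :
  (forall t, std_simplex t -> t ord0 i = 0 -> mev p t = 0) ->
  forall m, m \in msupp p -> (0 < m i)%N.
Proof.
move=> p0 m mp; rewrite lt0n; apply/negP => /eqP mi.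
pose p1 := \sum_(m <- msupp p | m i == 0%N) mcoeff m p *: mpolyX R m.
have p1E t : mev p1 t = mev p (\row_j if j == i then 0 else t ord0 j).
  rewrite [in RHS](mpolyE p) !mev_sum big_mkcond; apply: eq_bigr => k _.
  rewrite mevZ mevX; case: ifPn => [/eqP ki|ki].
    rewrite mevZ mevX; congr (_ * _); apply: eq_bigr => j _; rewrite mxE.
    by case: eqP => // ->; rewrite ki !expr0.
  rewrite mevZ mevX (bigD1 i)//= mxE eqxx expr0n (negPf ki) mul0r mulr0//.
have p10 : p1 = 0.
  apply: (mpoly_vanish_open open_open_simplex open_simplex_center) => t [t0 t1].
  rewrite p1E; apply: p0; last by rewrite mxE eqxx.
  split=> [j|]; first by rewrite mxE; case: ifP => // _; exact: ltW.
  apply: le_trans (ltW t1); apply: ler_sum => j _; rewrite mxE.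
  by case: ifP => // _; exact: ltW.
have : mcoeff m p1 = mcoeff m p.
  rewrite /p1 raddf_sum/= -big_filter (bigD1_seq m) /=.
  - rewrite mcoeffZ mcoeffX eqxx mulr1 big1 ?addr0// => k /negPf km.
    by rewrite mcoeffZ mcoeffX km mulr0.
  - by rewrite mem_filter mi eqxx.
  - by rewrite filter_uniq// msupp_uniq.
by rewrite p10 mcoeff0 => /esym/eqP; rewrite mcoeff_eq0 mp.
Qed.

Lemma mev_affine_of_msize q : (msize q <= 2)%N ->
  exists al (be : 'rV[R]_n), forall t, mev q t = al + \sum_i be ord0 i * t ord0 i.
Proof.
move=> q2; rewrite (mpolyE q) big_seq.
apply: (big_ind (fun q => exists al (be : 'rV[R]_n), forall t,
    mev q t = al + \sum_i be ord0 i * t ord0 i)).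
- exists 0, 0 => t; rewrite /mev meval0 big1 ?addr0// => i _.
  by rewrite mxE mul0r.
- move=> p1 p2 [a1 [b1 E1]] [a2 [b2 E2]]; exists (a1 + a2), (b1 + b2) => t.
  rewrite mevD /= E1 E2 addrACA -big_split/=; congr (_ + _).
  by apply: eq_bigr => i _; rewrite mxE mulrDl.
- move=> m mq; have := leq_trans (msize_mdeg_lt mq) q2; rewrite ltnS.
  rewrite leq_eqVlt ltnS leqn0 => /orP[|].
    rewrite mdeg_eq1 => /existsP[i /eqP ->].
    exists 0, (mcoeff (mnm1 i) q *: delta_mx ord0 i) => t.
    rewrite mevZ add0r (bigD1 i)//= !mxE !eqxx mulr1 big1 ?addr0.
      by rewrite /mev mevalXU.
    by move=> j /negPf ji; rewrite !mxE ji andbF mulr0 mul0r.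
  rewrite mdeg_eq0 => /eqP ->; exists (mcoeff mnm0 q), 0 => t.
  rewrite mevZ mpolyX0 /mev meval1 mulr1 big1 ?addr0// => i _.
  by rewrite mxE mul0r.
Qed.

Definition simplex_bubble t : R := (\prod_i t ord0 i) * (1 - \sum_i t ord0 i).

(** All monomials are divisible by the product of the variables, and the quotient
has degree at most one; it vanishes on the facet where the coordinates sum to
one. *)
Lemma facet_vanish_bubble p : (msize p <= n.+2)%N ->
  (forall t i, std_simplex t -> t ord0 i = 0 -> mev p t = 0) ->
  (forall t, std_simplex t -> \sum_i t ord0 i = 1 -> mev p t = 0) ->
  exists c, forall t, mev p t = c * simplex_bubble t.
Proof.
move=> pn p0 p1.
pose ones : multinom n := Multinom [tuple 1%N | i < n].
pose q := \sum_(m <- msupp p) mcoeff m p *: mpolyX R (mnm_sub m ones).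
have pE t : mev p t = (\prod_i t ord0 i) * mev q t.
  rewrite [in LHS](mpolyE p) /q !mev_sum mulr_sumr big_seq [RHS]big_seq.
  apply: eq_bigr => m mp; rewrite !mevZ !mevX mulrCA; congr (_ * _).
  rewrite -big_split/=; apply: eq_bigr => i _.
  rewrite mnmBE mnmE -exprS subn1 prednK//.
  by apply: facet_vanish_msupp mp => t'; exact: p0.
have q2 : (msize q <= 2)%N.
  rewrite /q big_seq; apply: msize_sum_le => m mp.
  apply: leq_trans (msizeZ_le _ _) _; rewrite msizeX ltnS.
  have := leq_trans (msize_mdeg_lt mp) pn; rewrite ltnS.
  have -> : m = mnm_add (mnm_sub m ones) ones.
    apply/mnmP => i; rewrite mnmDE mnmBE mnmE subnK//.
    by apply: facet_vanish_msupp mp => t'; exact: p0.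
  rewrite mdegD [mdeg ones]mdegE.
  under eq_bigr do rewrite mnmE.
  rewrite sum1_card card_ord -[X in (_ <= X)%N -> _]add1n leq_add2r.
  apply: leq_trans; rewrite !mdegE; apply: leq_sum => i _.
  by rewrite mnmBE mnmDE addnK.
have [al [be qE]] := mev_affine_of_msize q2.
pose ga i := al + be ord0 i.
have ga1 t : (forall i, 0 < t ord0 i) -> \sum_i t ord0 i = 1 ->
    \sum_i ga i * t ord0 i = 0.
  move=> t0 t1; rewrite (_ : \sum_i _ = mev q t); last first.
    rewrite qE -[X in X + _]mulr1 -t1 mulr_sumr -big_split/=.
    by apply: eq_bigr => i _; rewrite -mulrDl.
  have st : std_simplex t by split=> [i|]; [exact: ltW|rewrite t1].
  have := p1 t st t1.
  rewrite pE => /eqP; rewrite mulf_eq0 => /orP[|/eqP//].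
  by rewrite gt_eqF// prodr_gt0.
(* the affine quotient agrees with the linear form ga on that facet, hence ga
   vanishes there, and on the positive orthant by homogeneity *)
have gaT (t : 'rV[R]_n) : (0 < n)%N -> (forall i, 0 < t ord0 i) ->
    \sum_i ga i * t ord0 i = 0.
  move=> n0 t0; pose s := \sum_i t ord0 i.
  have s0 : 0 < s.
    rewrite /s (bigD1 (Ordinal n0))//=; apply: ltr_wpDr => //.
    by apply: sumr_ge0 => i _; exact: ltW.
  have := @ga1 (s^-1 *: t).
  rewrite (_ : \sum_i ga i * _ = s^-1 * \sum_i ga i * t ord0 i); last first.
    by rewrite mulr_sumr; apply: eq_bigr => i _; rewrite mxE mulrCA.
  move=> H; have /eqP : s^-1 * \sum_i ga i * t ord0 i = 0.
    apply: H => [i|]; first by rewrite mxE mulr_gt0// invr_gt0.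
    under eq_bigr do rewrite mxE.
    by rewrite -mulr_sumr mulVf// gt_eqF.
  by rewrite mulf_eq0 invr_eq0 gt_eqF//= => /eqP.
have ga0 i : ga i = 0.
  have n0 : (0 < n)%N by exact: leq_ltn_trans (ltn_ord i).
  have h1 := gaT (const_mx 1) n0 (fun j => ltac:(by rewrite mxE)).
  have h2 : \sum_j ga j * (const_mx 1 + delta_mx ord0 i : 'rV[R]_n) ord0 j = 0.
    by apply: gaT => // j; rewrite !mxE eqxx/=; case: (j == i) => /=; lra.
  have : \sum_j ga j * (const_mx 1 + delta_mx ord0 i : 'rV[R]_n) ord0 j =
      \sum_j ga j * (const_mx 1 : 'rV[R]_n) ord0 j + ga i.
    rewrite -[X in _ = _ + X]mulr1 -[in RHS](mulr1 (ga i)).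
    rewrite (eq_bigr (fun j => ga j * (const_mx 1 : 'rV[R]_n) ord0 j + ga j * (j == i)%:R)).
      rewrite big_split/=; congr (_ + _).
      rewrite (bigD1 i)//= eqxx !mulr1 big1 ?addr0// => j /negPf ->.
      by rewrite mulr0.
    by move=> j _; rewrite !mxE eqxx/= mulrDr.
  by rewrite h1 h2 add0r => <-.
exists al => t; rewrite pE /simplex_bubble qE mulrCA; congr (_ * _).
rewrite mulrBr mulr1 mulr_sumr -sumrN; congr (_ + _); apply: eq_bigr => i _.
have /eqP := ga0 i; rewrite /ga addr_eq0 => /eqP ->.
by rewrite mulNr opprK.
Qed.

End polynomial_vanishing.

(** * Affine substitutions and integrals over the standard simplex *)

Section composition.
Variable R : realType.

Lemma msize_affine n (g : 'rV[R]_n) c : (msize (affine_mpoly g c) <= 2)%N.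
Proof.
apply: leq_trans (msizeD_le _ _) _; rewrite geq_max; apply/andP; split.
  by rewrite msizeC; case: (_ == _).
apply: msize_sum_le => i _.
by apply: leq_trans (msizeZ_le _ _) _; rewrite msizeX mdeg1.
Qed.

Lemma msizeM_deg n (p q : mpoly n R) d e : (msize p <= d.+1)%N -> (msize q <= e.+1)%N ->
  (msize (p * q) <= (d + e).+1)%N.
Proof.
move=> pd qe; have [->|p0] := eqVneq p 0; first by rewrite mul0r msize0.
have [->|q0] := eqVneq q 0; first by rewrite mulr0 msize0.
by rewrite msizeM// -subn1 leq_subLR add1n -addSn -addnS leq_add.
Qed.

Lemma mev_comp_affine m n (p : mpoly m R) (v : 'rV[R]_m) (E : 'M[R]_(n, m)) d :
  (msize p <= d.+1)%N ->
  exists2 q : mpoly n R, (msize q <= d.+1)%N & forall t, mev q t = mev p (v + t *m E).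
Proof.
move=> pd; pose l i := affine_mpoly (col i E)^T (v ord0 i).
have lE i t : mev (l i) t = (v + t *m E) ord0 i.
  rewrite mev_affine !mxE; congr (_ + _); apply: eq_bigr => j _.
  by rewrite !mxE mulrC.
exists (\sum_(k <- msupp p) mcoeff k p *: \prod_i l i ^+ k i).
  rewrite big_seq; apply: msize_sum_le => k kp.
  apply: leq_trans (msizeZ_le _ _) _.
  apply: leq_trans _ (leq_trans (msize_mdeg_lt kp) pd); rewrite mdegE.
  apply: (big_ind2 (fun q e => msize q <= e.+1)%N).
  - by rewrite msize1.
  - by move=> q1 e1 q2 e2; exact: msizeM_deg.
  - move=> i _; elim: (k i) => [|e IH]; first by rewrite expr0 msize1.
    by rewrite exprS; exact: (msizeM_deg (msize_affine _ _) IH).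
move=> t; rewrite [in RHS](mpolyE p) !mev_sum; apply: eq_bigr => k _.
rewrite !mevZ mevX; congr (_ * _); rewrite /mev rmorph_prod/=; apply: eq_bigr => i _.
by rewrite rmorphXn/=; congr (_ ^+ _); exact: lE.
Qed.

End composition.

Section simplex_integrals.
Variables (R : realType) (n : nat).
Notation mu := (lebesgue_rV R n).
Notation S := (@std_simplex R n).
Implicit Types p q : mpoly n R.

Lemma measurable_std_simplex : measurable S.
Proof.
rewrite (_ : S = [set t : 'rV[R]_n | forall i, 0 <= t ord0 i] `&`
    [set t : 'rV[R]_n | 0 <= 1 - \sum_i t ord0 i]).
  apply: measurableI; last first.
    apply: (@measurable_ge0 R n (fun t => 1 - \sum_i t ord0 i)).
    apply: measurable_funB; first exact: measurable_cst.
    by apply: measurable_sum => i; exact: measurable_coord.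
  apply: (@measurable_forall _ _ _ (fun i (t : 'rV[R]_n) => 0 <= t ord0 i)) => i.
  apply: (@measurable_ge0 R n (fun t => t ord0 i)).
  exact: measurable_coord.
by apply/seteqP; split=> t /=; rewrite subr_ge0.
Qed.

Lemma std_simplex_cube : S `<=` cube n 2.
Proof.
move=> t [t0 t1] i; have ti := t0 i.
have : t ord0 i <= 1.
  by apply: le_trans t1; rewrite (bigD1 i)//= lerDl; apply: sumr_ge0.
lra.
Qed.

Lemma mev_integrable_simplex p : mu.-integrable S (EFin \o mev p).
Proof.
have [M HM] := continuous_bounded_cube 2 (@mev_continuous R n p).
apply: measurable_bounded_integrable.
- exact: measurable_std_simplex.
- exact: lebesgue_bounded measurable_std_simplex std_simplex_cube.
- by apply: measurable_funTS; exact: measurable_mev.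
- exists M; split; first exact: num_real.
  move=> N MN x Sx; apply: le_trans (ltW MN); apply: HM; exact: std_simplex_cube.
Qed.

Lemma simplex_integral_eq0 p : (forall t, S t -> 0 <= mev p t) ->
  \int[mu]_(t in S) mev p t = 0 -> p = 0.
Proof.
move=> p0 Ip; pose f := mev p \_ S.
have f0 t : 0 <= f t.
  by rewrite /f patchE; case: ifPn => // tS; apply: p0; rewrite inE in tS.
have intf : mu.-integrable setT (EFin \o f).
  have := mev_integrable_simplex p.
  rewrite (integrable_mkcond _ measurable_std_simplex).
  by apply: eq_integrable => // t _; rewrite /= /f !patchE; case: ifP.
have If : \int[mu]_t f t = 0 by rewrite -Ip [RHS]Rintegral_mkcond.
apply: (mpoly_vanish_open (@open_open_simplex R n) (@open_simplex_center R n)).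
move=> t ot; apply/eqP; apply: contrapT => /negP pt.
have nV : nbhs t (@open_simplex R n `&` [set y | mev p y != 0]).
  apply: filterI; first by apply: open_nbhs_nbhs; split => //; exact: open_open_simplex.
  apply: open_nbhs_nbhs; split => //.
  apply: (@open_comp _ _ (mev p) [set y | y != 0]) => [x _|]; first exact: mev_continuous.
  exact: open_neq.
have [y [oy /= py] fy] := integral_eq0_nbhs f0 intf If nV.
move: fy; rewrite /f patchE mem_set; last exact: open_simplex_sub oy.
by move/eqP; rewrite (negPf py).
Qed.

Definition bubble_mpoly : mpoly n R :=
  (\prod_i mpolyX R (mnm1 i)) * affine_mpoly (const_mx (-1)) 1.

Lemma mev_bubble t : mev bubble_mpoly t = simplex_bubble t.
Proof.
rewrite mevM /= mev_affine /simplex_bubble; congr (_ * _).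
  by rewrite /mev rmorph_prod/=; apply: eq_bigr => i _; rewrite mevalXU.
rewrite -sumrN; congr (_ + _); apply: eq_bigr => i _.
by rewrite mxE mulN1r.
Qed.

(** The affine functions form a space of dimension at least two, so some nonzero one
is orthogonal to the bubble. *)
Lemma bubble_orthogonal (i : 'I_n) : exists g c,
  affine_mpoly g c != 0 /\
  \int[mu]_(t in S) mev (bubble_mpoly * affine_mpoly g c) t = 0.
Proof.
pose B0 := \int[mu]_(t in S) mev bubble_mpoly t.
pose B1 := \int[mu]_(t in S) mev (bubble_mpoly * mpolyX R (mnm1 i)) t.
have B00 : B0 != 0.
  apply/eqP => B00.
  have b0 : bubble_mpoly = 0.
    apply: simplex_integral_eq0 => // t [t0 t1]; rewrite mev_bubble mulr_ge0//.
      exact: prodr_ge0.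
    by rewrite subr_ge0.
  have := mev_bubble (const_mx (n.+1%:R^-1)); rewrite b0 /mev meval0 => /eqP.
  have [h0 h1] := @open_simplex_center R n.
  by rewrite eq_sym mulf_eq0 !gt_eqF// ?subr_gt0// prodr_gt0.
(* the combination B1 - B0 t_i of the functions 1 and t_i *)
exists (- B0 *: delta_mx ord0 i), B1; split.
  apply: contra_neq B00 => A0.
  have := mderiv_affine (- B0 *: delta_mx ord0 i) B1 i.
  rewrite A0 mderiv0 !mxE !eqxx mulr1 => /esym/eqP.
  by rewrite mpolyC_eq0 oppr_eq0 => /eqP.
have E t : mev (bubble_mpoly * affine_mpoly (- B0 *: delta_mx ord0 i) B1) t =
    B1 * mev bubble_mpoly t - B0 * mev (bubble_mpoly * mpolyX R (mnm1 i)) t.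
  have Ea : mev (affine_mpoly (- B0 *: delta_mx ord0 i) B1) t = B1 - B0 * t ord0 i.
    rewrite mev_affine (bigD1 i)//= !mxE !eqxx big1 ?addr0; first by rewrite mulr1 mulNr.
    by move=> j /negPf ji; rewrite !mxE ji andbF mulr0 mul0r.
  rewrite !(mevM bubble_mpoly) /= Ea [mev (mpolyX _ _) _]mevalXU; ring.
under eq_Rintegral do rewrite E.
have mS := measurable_std_simplex.
have i1 := mev_integrable_simplex bubble_mpoly.
have i2 := mev_integrable_simplex (bubble_mpoly * mpolyX R (mnm1 i)).
rewrite RintegralB//.
- by rewrite !RintegralZl// -/B0 -/B1; ring.
- have := mev_integrable_simplex (B1 *: bubble_mpoly).
  by apply: eq_integrable => // t _ /=; rewrite mevZ.
- have := mev_integrable_simplex (B0 *: (bubble_mpoly * mpolyX R (mnm1 i))).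
  by apply: eq_integrable => // t _ /=; rewrite mevZ.
Qed.

End simplex_integrals.

(** * Parametrization of the face, and the theorem *)

Section face_parametrization.
Variables (R : realType) (n : nat).
Variables (a : 'rV[R]_n.+1) (b : 'I_n.+1 -> 'rV[R]_n.+1).
Hypothesis hK : affinely_independent (cone a b).
Let E : 'M[R]_(n, n.+1) := \matrix_i (b (lift ord0 i) - b ord0).
Implicit Types t : 'rV[R]_n.

Let weight t (j : 'I_n.+1) : R :=
  oapp (fun i => t ord0 i) (1 - \sum_i t ord0 i) (unlift ord0 j).

Lemma weight0 t : weight t ord0 = 1 - \sum_i t ord0 i.
Proof. by rewrite /weight unlift_none. Qed.

Lemma weightS t i : weight t (lift ord0 i) = t ord0 i.
Proof. by rewrite /weight liftK. Qed.

Lemma sum_weight t : \sum_j weight t j = 1.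
Proof.
rewrite big_ord_recl weight0.
have -> : \sum_i weight t (lift ord0 i) = \sum_i t ord0 i.
  by apply: eq_bigr => i _; exact: weightS.
by rewrite subrK.
Qed.

Lemma face_paramE t : b ord0 + t *m E = \sum_j weight t j *: b j.
Proof.
rewrite big_ord_recl weight0 scalerBl scale1r -addrA; congr (_ + _).
rewrite mulmx_sum_row scaler_suml addrC -sumrB; apply: eq_bigr => i _.
by rewrite rowK weightS scalerBr.
Qed.

Lemma bary_face_param0 t : bary a b (b ord0 + t *m E) ord0 = 1 - \sum_i t ord0 i.
Proof. by rewrite face_paramE (bary_b_sum hK) ?weight0 ?sum_weight. Qed.

Lemma bary_face_paramS t i : bary a b (b ord0 + t *m E) (lift ord0 i) = t ord0 i.
Proof. by rewrite face_paramE (bary_b_sum hK) ?weightS ?sum_weight. Qed.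

Lemma hull_face_param t : std_simplex t -> hull b (b ord0 + t *m E).
Proof.
move=> [t0 t1]; exists (weight t); split; last exact: face_paramE.
  move=> j; have [i ->|->] := unliftP ord0 j; first by rewrite weightS.
  by rewrite weight0 subr_ge0.
exact: sum_weight.
Qed.

(** Bordering E by the unit normal gives an invertible square matrix B, with
det (B B^T) = det (E E^T). *)
Lemma jacobian_neq0 nu : unit_normal (hull b) nu ->
  Num.sqrt (\det (E *m E^T)) != 0.
Proof.
move=> [nu1 nuE].
have nuET : nu *m E^T = 0.
  apply/rowP => i; rewrite [RHS]mxE.
  rewrite -(nuE (b (lift ord0 i)) (b ord0)) ?mxE; try exact: hull_vertex.
  by rewrite /dot !mxE; apply: eq_bigr => j _; rewrite !mxE.
pose B : 'M[R]_(1 + n) := col_mx nu E.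
have BB : \det (B *m B^T) = \det (E *m E^T).
  rewrite tr_col_mx mul_col_row nuET det_lblock det_mx11.
  by move: nu1; rewrite /dot => ->; rewrite mul1r.
have Bu : B \in unitmx.
  rewrite -row_free_unit; apply: inj_row_free => v.
  rewrite -[v]hsubmxK mul_row_col; set s := lsubmx v; set t := rsubmx v => H.
  have s0 : s = 0.
    have : (s *m nu + t *m E) *m nu^T = 0 by rewrite H mul0mx.
    rewrite mulmxDl -!mulmxA -[E *m nu^T]trmxK trmx_mul trmxK nuET trmx0 mulmx0 addr0.
    have -> : nu *m nu^T = 1%:M.
      by apply/matrixP => i j; rewrite !ord1 [RHS]mxE -nu1.
    by rewrite mulmx1.
  move: H; rewrite s0 mul0mx add0r => tE.
  have -> : t = 0.
    apply/rowP => i; rewrite [RHS]mxE -bary_face_paramS tE addr0 (bary_b hK).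
    by rewrite (negPf (neq_lift _ _)).
  by rewrite row_mx0.
have Bd : 0 < \det (E *m E^T).
  rewrite -BB det_mulmx det_tr -expr2 exprn_even_gt0//=.
  by rewrite -unitfE -unitmxE.
by rewrite gt_eqF// sqrtr_gt0.
Qed.

End face_parametrization.

(* The space dimension is n.+1; a and a' are the vertices a_1 and a_1', and the
   b i are the shared vertices a_2, a_3 and so on. *)
Theorem theorem5p2 (R : realType) (n k : nat) (hn : (2 <= n.+1)%N)
    (a a' : 'rV[R]_n.+1) (b : 'I_n.+1 -> 'rV[R]_n.+1)
    (hK : affinely_independent (cone a b))
    (hK' : affinely_independent (cone a' b))
    (hF : hull (cone a b) `&` hull (cone a' b) = hull b)
    (hplane : forall S : {set 'I_n.+1}, (1 <= #|S| <= n)%N ->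
      ~ exists A : set 'rV[R]_n.+1,
        [/\ affine_plane #|S| A,
            hull (cone a (subfamily (mem S) b)) `<=` A &
            hull (cone a' (subfamily (mem S) b)) `<=` A])
    (nuF : 'rV[R]_n.+1) (hnuF : unit_normal (hull b) nuF)
    (hk : (k <= n)%N) :
  exists2 mu : 'rV[R]_n.+1 -> 'rV[R]_n.+1,
    poly_vec 1 (hull b) mu &
    forall tau sigma sigma' : 'rV[R]_n.+1 -> 'M[R]_n.+1,
      face_bubble k.+1 a a' b tau sigma sigma' ->
      ~ (forall p : 'rV[R]_n.+1 -> 'rV[R]_n.+1, poly_vec 1 (hull b) p ->
           simplex_integral b (fun x => dot (mxapp (sigma x) nuF) (p x)) =
           simplex_integral b (fun x => dot (mu x) (p x))).
Proof.
have n0 : (0 < n)%N by [].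
have [g [c [A0 orth]]] := bubble_orthogonal R (Ordinal n0).
(* the affine function of bubble_orthogonal, extended from the face to the space *)
pose q x := c + \sum_i g ord0 i * bary a b x (lift ord0 i).
have qE : q = mev (affine_mpoly (\sum_i g ord0 i *: grad a b (lift ord0 i))
   (c - \sum_i g ord0 i * dot (grad a b (lift ord0 i)) a)).
  apply/funext => x; rewrite mev_affine -dotE dot_suml /q -addrA; congr (_ + _).
  rewrite addrC -sumrB; apply: eq_bigr => i _.
  by rewrite dotZl baryE dotBr mulrBr.
have pmu : poly_vec 1 (hull b) (fun x => q x *: nuF).
  move=> i; rewrite qE; set A := affine_mpoly _ _.
  exists (nuF ord0 i *: A); last by move=> x _; rewrite mxE mulrC -mevZ.
  by apply: leq_trans (msizeZ_le _ _) _; exact: msize_affine.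
exists (fun x => q x *: nuF) => // tau sigma sigma' fb H.
have := H _ pmu; rewrite /simplex_integral.
set E := \matrix_i _.
move=> /(mulfI (jacobian_neq0 hK hnuF)).
have qt t : q (b ord0 + t *m E) = mev (affine_mpoly g c) t.
  rewrite mev_affine /q; congr (_ + _); apply: eq_bigr => i _.
  by rewrite bary_face_paramS.
have nn : dot nuF nuF = 1 by have [] := hnuF.
have [_ [[_ polS] _] _ _ _] := fb.
have hsub x : hull b x -> hull (cone a b) x by rewrite -hF => -[].
have [P Psz PE] : exists2 P : mpoly n.+1 R, (msize P <= n.+2)%N &
    forall x, hull b x -> mev P x = dot (mxapp (sigma x) nuF) nuF.
  have /choice[p pP] (ij : 'I_n.+1 * 'I_n.+1) : exists p : mpoly n.+1 R,
      (msize p <= n.+2)%N /\ forall x, hull (cone a b) x -> sigma x ij.1 ij.2 = mev p x.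
    have [p psz pE] := polS ij.1 ij.2; exists p; split=> //.
    by apply: leq_trans psz _; rewrite !ltnS.
  exists (\sum_i \sum_j (nuF ord0 i * nuF ord0 j) *: p (i, j)).
    apply: msize_sum_le => i _; apply: msize_sum_le => j _.
    by apply: leq_trans (msizeZ_le _ _) _; have [] := pP (i, j).
  move=> x /hsub Kx; rewrite mev_sum dotE; apply: eq_bigr => i _.
  rewrite mev_sum mxappE mxE mulr_suml; apply: eq_bigr => j _.
  by rewrite mevZ mxE -(pP (i, j)).2//=; ring.
(* the normal-normal component pulled back to the standard simplex *)
have [Q Qsz QE] := mev_comp_affine (b ord0) E Psz.
have vanish t j : std_simplex t -> bary a b (b ord0 + t *m E) j = 0 -> mev Q t = 0.
  move=> St tj; have Fx := hull_face_param b St.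
  rewrite QE PE//; apply: (normal_normal_vanish _ hK hK' hF _ hnuF fb Fx tj) => //.
have [cQ QB] : exists cQ, forall t, mev Q t = cQ * simplex_bubble t.
  apply: facet_vanish_bubble Qsz _ _ => [t i St ti|t St t1].
    by apply: (vanish t (lift ord0 i)) => //; rewrite bary_face_paramS.
  by apply: (vanish t ord0) => //; rewrite bary_face_param0// t1 subrr.
set A := affine_mpoly g c in A0 orth qt.
have -> : \int[lebesgue_rV R n]_(t in @std_simplex R n)
      dot (mxapp (sigma (b ord0 + t *m E)) nuF) (q (b ord0 + t *m E) *: nuF) = 0.
  transitivity (\int[lebesgue_rV R n]_(t in @std_simplex R n)
      (cQ * mev (bubble_mpoly R n * A) t)).
    apply: eq_Rintegral => t /set_mem St.
    rewrite dotZr qt -PE; last exact: hull_face_param.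
    by rewrite -QE QB (mevM (bubble_mpoly R n)) /= mev_bubble; ring.
  rewrite RintegralZl ?orth ?mulr0//; first exact: measurable_std_simplex.
  exact: mev_integrable_simplex.
(* the left-hand side of the moment condition is zero for p = mu *)
move=> /esym I0; suff : A * A = 0 by move/eqP; rewrite mulf_eq0 orbb (negPf A0).
apply: simplex_integral_eq0 => [t _|]; first by rewrite mevM /= -expr2 sqr_ge0.
rewrite -I0; apply: eq_Rintegral => t _.
by rewrite dotZl dotZr nn qt mulr1 mevM.
Qed.
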